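(* Let $n\ge2$ and let $G$ be the free group on $u_1,\dots,u_n$. Let $a,b$ be real numbers with $-1\le a\le1$ and $\frac{na^2-1}{n-1}\le b\le1$, and let $\psi_{a,b}$ be the state on $G$ given by $\psi_{a,b}(s)=a^{|s|-2\gamma(s)}b^{\gamma(s)}$. Then $\psi_{a,b}$ is reduced if and only if $$b\le\frac{1-na^2}{n-1}.$$
   Context: For $s\in G$ (a reduced word in $u_1^{\pm1},\dots,u_n^{\pm1}$), $|s|$ is its length and $\gamma(s)$ is the number of positions where a letter $u_i^{-1}$ is immediately followed by a letter $u_j$ (number of negative-to-positive exponent changes from left to right). Convention $0^0=1$. A state on $G$ is a positive definite function with value $1$ at the identity; under the stated inequalities $\psi_{a,b}$ is positive definite. A state is reduced if its linear extension to $\mathbb{C}G$ extends to a positive linear functional on the reduced C*-algebra $C^*_r(G)$ (the operator-norm closure of the image of $\mathbb{C}G$ under the left regular representation on $\ell^2(G)$); equivalently, its GNS representation is weakly contained in the left regular representation. *)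

(* Defs.v *)
From HB Require Import structures.
From mathcomp Require Import all_boot all_order all_algebra.
From mathcomp Require Import finmap complex.
From mathcomp Require Import mathcomp_extra boolp classical_sets functions.
From mathcomp Require Import cardinality fsbigop reals ereal esum.
From mathcomp Require Import ring lra zify.
Set Implicit Arguments.
Unset Strict Implicit.
Unset Printing Implicit Defensive.
Import Order.TTheory GRing.Theory Num.Theory.
Local Open Scope ring_scope.

Section FreeGroup.
Variable n : nat.

(* (i, true) is the letter u_i and (i, false) is the letter u_i^{-1}. *)
Definition letter : Type := ('I_n * bool)%type.
HB.instance Definition _ := Choice.on letter.

Definition inv_letter (l : letter) : letter := (l.1, ~~ l.2).

Definition reduced_word (w : seq letter) : bool :=
  sorted (fun l l' => l' != inv_letter l) w.

(* The reduced form of l w, for w reduced. *)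
Definition push (l : letter) (w : seq letter) : seq letter :=
  if w is l' :: w' then if l' == inv_letter l then w' else l :: w
  else [:: l].

Definition word_mul (v w : seq letter) : seq letter := foldr push w v.
Definition word_inv (w : seq letter) : seq letter := rev (map inv_letter w).

Lemma inv_letterK : involutive inv_letter.
Proof. by case=> i e; rewrite /inv_letter /= negbK. Qed.

Lemma inv_letter_neq l : inv_letter l != l.
Proof. by case: l => i [] ; rewrite /inv_letter xpair_eqE /= andbF. Qed.

Lemma reduced_push l w : reduced_word w -> reduced_word (push l w).
Proof.
case: w => [|l' w] //= rw; case: ifP => [_|/negbT ll'] /=; last by rewrite ll'.
exact: path_sorted rw.
Qed.

Lemma reduced_mul v w : reduced_word w -> reduced_word (word_mul v w).
Proof. by move=> rw; elim: v => //= l v; exact: reduced_push. Qed.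

Lemma pushK l w : reduced_word w -> push l (push (inv_letter l) w) = w.
Proof.
case: w => [|l' w] /= rw; first by rewrite eqxx.
rewrite inv_letterK; case: eqP => [E|_] /=; last by rewrite eqxx.
by rewrite -E; case: w rw => [|l'' w] //= /andP[/negbTE ->].
Qed.

Lemma word_mul_push l v w : reduced_word v -> reduced_word w ->
  word_mul (push l v) w = push l (word_mul v w).
Proof.
case: v => [|l' v] //= rv rw; case: eqP => [->|_] //=.
by rewrite pushK // reduced_mul.
Qed.

Lemma word_mulA u v w : reduced_word v -> reduced_word w ->
  word_mul u (word_mul v w) = word_mul (word_mul u v) w.
Proof.
move=> rv rw; elim: u => //= l u ->.
by rewrite word_mul_push // reduced_mul.
Qed.

Lemma word_mul0 v : reduced_word v -> word_mul v [::] = v.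
Proof.
elim: v => //= l v IH rv; rewrite IH; last exact: path_sorted rv.
by case: v rv {IH} => //= l' v /andP[/negbTE ->].
Qed.

Lemma reduced_inv w : reduced_word w -> reduced_word (word_inv w).
Proof.
rewrite /reduced_word /word_inv rev_sorted sorted_map.
apply: sub_sorted => x y /=.
by rewrite inv_letterK eq_sym (can2_eq inv_letterK inv_letterK).
Qed.

Lemma word_mulV w : word_mul (word_inv w) w = [::].
Proof.
elim: w => //= l w IH; rewrite /word_inv /= rev_cons /word_mul -cats1 foldr_cat /=.
by rewrite inv_letterK eqxx.
Qed.

Lemma word_invK : involutive word_inv.
Proof.
move=> w; rewrite /word_inv map_rev revK -map_comp map_id_in // => x _ /=.
exact: inv_letterK.
Qed.

Record free_group : Type :=
  FreeGroup { word :> seq letter; word_reduced : reduced_word word }.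

HB.instance Definition _ := [isSub for word].
HB.instance Definition _ := [Choice of free_group by <:].

Definition fg_one : free_group := @FreeGroup [::] isT.
Definition fg_mul (s t : free_group) : free_group :=
  FreeGroup (reduced_mul s (word_reduced t)).
Definition fg_inv (s : free_group) : free_group :=
  FreeGroup (reduced_inv (word_reduced s)).

Lemma fg_mulA : associative fg_mul.
Proof. by move=> s t u; apply: val_inj; rewrite /= word_mulA // word_reduced. Qed.
Lemma fg_mul1g : left_id fg_one fg_mul.
Proof. by move=> s; exact: val_inj. Qed.
Lemma fg_mulg1 : right_id fg_one fg_mul.
Proof. by move=> s; apply: val_inj; rewrite /= word_mul0 // word_reduced. Qed.
Lemma fg_mulVg : left_inverse fg_one fg_inv fg_mul.
Proof. by move=> s; apply: val_inj; rewrite /= word_mulV. Qed.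
Lemma fg_mulgV : right_inverse fg_one fg_inv fg_mul.
Proof.
by move=> s; apply: val_inj; rewrite /= -{1}[word s]word_invK word_mulV.
Qed.

HB.instance Definition _ :=
  isGroup.Build free_group fg_mulA fg_mul1g fg_mulg1 fg_mulVg fg_mulgV.

Definition gamma (s : free_group) : nat :=
  count (fun p : letter * letter => ~~ p.1.2 && p.2.2) (zip s (behead s)).

(* Hence the truncated subtraction in psi is the true one. *)
Lemma gamma_le (s : free_group) : (2 * gamma s <= size s)%N.
Proof.
rewrite /gamma; case: s => /= w _; set p := (X in count X).
have [m] := ubnP (size w); elim: m w => // m IH [|x [|y w]] // sw.
have IHy := IH (y :: w) sw.
have -> : zip [:: x, y & w] (behead [:: x, y & w])
          = (x, y) :: zip (y :: w) (behead (y :: w)) by [].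
rewrite [count _ _]/=; have [/andP[_ y2]|_] := boolP (p (x, y)); last first.
  by rewrite add0n (leq_trans IHy).
case: w sw IHy => [|z w] // sw _.
have -> : zip [:: y, z & w] (behead [:: y, z & w])
          = (y, z) :: zip (z :: w) (behead (z :: w)) by [].
have -> : count p ((y, z) :: zip (z :: w) (behead (z :: w)))
          = count p (zip (z :: w) (behead (z :: w))).
  by rewrite [LHS]/= /p /= -/p (y2 : y.2 = true).
have := IH (z :: w) (ltnW sw); rewrite /size -/size.
by move: (count _ _) => c; lia.
Qed.

(* x ^+ 0 = 1 for every x, including x = 0. *)
Definition psi (R : realType) (a b : R) (s : free_group) : R[i] :=
  (a ^+ (size s - 2 * gamma s) * b ^+ gamma s)%:C%C.

End FreeGroup.

Section Ell2.
Variables (R : realType) (T : choiceType).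
Local Notation C := R[i].
Local Open Scope classical_set_scope.

Definition sqnormc (z : C) : R := complex.Re z ^+ 2 + complex.Im z ^+ 2.

Lemma sqnormc_ge0 z : 0 <= sqnormc z.
Proof. by rewrite addr_ge0 // sqr_ge0. Qed.

Definition sqsum (x : T -> C) : \bar R := \esum_(t in setT) (sqnormc (x t))%:E.

Definition sq_summable : {pred T -> C} := fun x => (sqsum x < +oo)%E.

Lemma sq_summable_submod : submod_closed sq_summable.
Proof.
have sc0 (f : T -> R) t : 0 <= f t -> (0 <= (f t)%:E)%E by rewrite lee_fin.
split.
  rewrite unfold_in /sqsum esum1 ?ltry // => t _.
  by rewrite /sqnormc /= expr0n addr0.
move=> c x y; rewrite !unfold_in => hx hy.
have e0 (z : T -> C) : (0 <= sqsum z)%E.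
  by apply: esum_ge0 => t _; rewrite lee_fin sqnormc_ge0.
pose k := 2 * sqnormc c.
have k0 : 0 <= k by rewrite mulr_ge0 // sqnormc_ge0.
have sumZ (r : R) (z : T -> C) : 0 <= r -> (sqsum z < +oo)%E ->
    (\esum_(t in setT) (r * sqnormc (z t))%:E < +oo)%E.
  move=> r0 hz; apply: (@le_lt_trans _ _ (r%:E * sqsum z)%E); last first.
    by rewrite lte_mul_pinfty // ?lee_fin.
  apply: ge_ereal_sup => _ [A [finA _] <-].
  under eq_fsbigr => t _ do rewrite EFinM.
  rewrite -ge0_mule_fsumr; last by move=> t; rewrite lee_fin sqnormc_ge0.
  apply: lee_pmul => //; rewrite ?lee_fin //.
    by apply: fsume_ge0 => t _; rewrite lee_fin sqnormc_ge0.
  by apply: ereal_sup_ubound; exists A.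
apply: (@le_lt_trans _ _ (\esum_(t in setT) ((k * sqnormc (x t))%:E
    + (2 * sqnormc (y t))%:E))%E).
  apply: le_esum => t _; rewrite -EFinD lee_fin /k /sqnormc /=.
  have -> : (c *: x + y) t = c * x t + y t by [].
  case: c (x t) (y t) {k k0} => [c1 c2] [x1 x2] [y1 y2] /=.
  have p := sqr_ge0 (c1 * x1 - c2 * x2 - y1).
  have q := sqr_ge0 (c1 * x2 + c2 * x1 - y2).
  rewrite -subr_ge0; apply: le_trans (addr_ge0 p q) _.
  by rewrite le_eqVlt; apply/orP; left; apply/eqP; ring.
rewrite esumD; first by rewrite lte_add_pinfty // sumZ.
  by move=> t _; rewrite lee_fin mulr_ge0 // sqnormc_ge0.
by move=> t _; rewrite lee_fin mulr_ge0 // sqnormc_ge0.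
Qed.

HB.instance Definition _ :=
  GRing.isSubmodClosed.Build C (T -> C) sq_summable sq_summable_submod.

Record ell2 : Type := Ell2 { ell2_fun :> T -> C; ell2P : ell2_fun \in sq_summable }.
HB.instance Definition _ := [isSub for ell2_fun].
HB.instance Definition _ := [Choice of ell2 by <:].
HB.instance Definition _ := [SubChoice_isSubLmodule of ell2 by <:].

Definition norm2 (x : ell2) : R := Num.sqrt (fine (sqsum x)).

(* Meaningful for absolutely summable f only, as are the products of two
   elements of l^2. *)
Definition sumR (f : T -> R) : R :=
  fine (\esum_(t in setT) (Num.max (f t) 0)%:E)
  - fine (\esum_(t in setT) (Num.max (- f t) 0)%:E).
Definition sumC (f : T -> C) : C :=
  (sumR (fun t => complex.Re (f t)) +i* sumR (fun t => complex.Im (f t)))%C.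

Definition inner (x y : ell2) : C := sumC (fun t => x t * (y t)^*%C).

Definition opnorm (S : ell2 -> ell2) : \bar R :=
  ereal_sup [set (norm2 (S x))%:E | x in [set x | norm2 x <= 1]].

Definition bounded_operator (S : ell2 -> ell2) : Prop :=
  linear S /\ (opnorm S < +oo)%E.

Definition is_adjoint (S S' : ell2 -> ell2) : Prop :=
  forall x y, inner (S x) y = inner x (S' y).

End Ell2.

Section Reduced.
Variables (R : realType) (G : groupType).
Local Notation C := R[i].
Local Notation H := (ell2 R G).
Local Open Scope classical_set_scope.

Definition positive_definite (phi : G -> C) : Prop :=
  forall (k : nat) (g : 'I_k -> G) (c : 'I_k -> C),
    0 <= \sum_(i < k) \sum_(j < k) (c i)^*%C * c j * phi ((g i)^-1 * g j)%g.

Definition is_state (phi : G -> C) : Prop :=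
  positive_definite phi /\ phi 1%g = 1.

Lemma translate_sq_summable (g : G) (x : H) :
  (fun h : G => x (g^-1 * h)%g) \in @sq_summable R G.
Proof.
have E : sqsum x = sqsum (fun h => x (g^-1 * h)%g).
  apply: (@reindex_esum R G G setT setT (fun h => (g^-1 * h)%g)).
  split=> //; first by move=> h h' _ _; exact: mulgI.
  by move=> h _; exists (g * h)%g; rewrite // mulKg.
by have := ell2P x; rewrite !unfold_in E.
Qed.

(* The left regular representation: it sends the basis vector at h to the one
   at g h. *)
Definition lreg (g : G) (x : H) : H := Ell2 (translate_sq_summable g x).

Definition group_algebra : Type := {fsfun G -> C with 0}.

Definition lreg_alg (f : group_algebra) : H -> H :=
  \sum_(g <- finsupp f) f g *: lreg g.

Definition lin_ext (phi : G -> C) (f : group_algebra) : C :=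
  \sum_(g <- finsupp f) f g * phi g.

Definition Cstar_r : set (H -> H) :=
  [set S | bounded_operator S /\
    forall e : R, 0 < e -> exists f, (opnorm (S - lreg_alg f)%R <= e%:E)%E].

(* Only the values of tau on C*_r(G) matter; the positive elements of a
   C*-algebra are those of the form S^* S. *)
Definition positive_functional (tau : (H -> H) -> C) : Prop :=
  (forall c S S', Cstar_r S -> Cstar_r S' ->
     tau (c *: S + S') = c * tau S + tau S') /\
  (forall S S', Cstar_r S -> Cstar_r S' -> is_adjoint S S' ->
     0 <= tau (S' \o S)).

Definition reduced_state (phi : G -> C) : Prop :=
  is_state phi /\
  exists tau : (H -> H) -> C, positive_functional tau /\
    forall f : group_algebra, tau (lreg_alg f) = lin_ext phi f.

End Reduced.

(* Main.v *)
Require Import Defs.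
From HB Require Import structures.
From mathcomp Require Import all_boot all_order all_algebra.
From mathcomp Require Import finmap complex.
From mathcomp Require Import boolp classical_sets functions.
From mathcomp Require Import cardinality fsbigop reals ereal esum.
From mathcomp Require Import ring lra zify.
Set Implicit Arguments.
Unset Strict Implicit.
Unset Printing Implicit Defensive.
Import Order.TTheory GRing.Theory Num.Theory.
Local Open Scope ring_scope.

(* For a positive definite phi that is square-summable on G, Cauchy-Schwarz against
   the image of the unit vector at 1 bounds |phi(f)| by a multiple of the operator norm
   of f, so phi extends to C*_r(G). A positive functional tau on C*_r(G) in turn
   satisfies tau(A) <= 4/3 |A| for self-adjoint A, since 1 - A is the square of an
   element of C*_r(G) as soon as |A| <= 3/4.
   psi_{a,b} is positive definite because it is multiplicative along the tree of blocks
   {g, g u_1, ..., g u_n}, on each of which its Gram matrix is positive semidefinite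
   exactly when (n a^2 - 1)/(n - 1) <= b <= 1.
   The sum of psi_{a,b}^2 over the words of length k grows like rho^k with
   rho = n a^2 + (n - 1) |b|. If rho <= 1, the functions psi_{ra,r^2 b} = r^{|s|} psi_{a,b}
   with r < 1 are square-summable, and their uniform bound passes to the limit r -> 1. If
   psi_{a,b} is reduced, Haagerup's inequality |f| <= (k + 1) |f|_2 on the sphere of
   radius k, applied to f = psi_{a,b}, makes that sum at most quadratic in k, so
   rho <= 1. *)

(** * Sums over discrete sets and the Hilbert space l^2 *)

(** Within the hypotheses the condition on b says exactly [rho <= 1]: for b < 0 the bound n a^2 + (n
    - 1)|b| <= 1 is the lower bound on b, for b >= 0 it is the condition itself. The obstacle is the
    limit r -> 1. At [rho = 1] square-summability may fail, and the constant that it supplies for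
    psi_{ra,r^2 b} depends on r. Square-summability is therefore used only to learn that these
    states are reduced; reducedness alone then bounds them all by one constant times the operator
    norm, and this constant survives the limit. The constants 4/3, 3 and 2 are not sharp. The limit
    needs independence of r, the converse needs polynomial growth in k. This is what permits the
    threshold 3/4, below which sqrt (1 - A) comes from an elementary contraction instead of
    functional calculus. *)

Section Reals.
Variable R : realType.

(** The intervals [u m - e m, u m + e m] meet pairwise, so the supremum of their left ends lies in
    all of them. *)
Lemma cauchy_limit (u e : nat -> R) :
  (forall m p, (m <= p)%N -> `|u p - u m| <= e m) ->
  exists l, forall m, `|l - u m| <= e m.
Proof.
move=> ue; pose E := [set r | exists m, r = u m - e m]%classic.
have up m p : u m - e m <= u p + e p.
  have e0 k : 0 <= e k by apply: le_trans (ue k k (leqnn k)).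
  case: (leqP m p) => [mp|/ltnW pm].
    by have := ue m p mp; have := e0 p; rewrite ler_norml; lra.
  by have := ue p m pm; have := e0 m; rewrite ler_norml; lra.
have supE : has_sup E.
  by split; [exists (u 0%N - e 0%N), 0%N | exists (u 0%N + e 0%N) => _ [m ->]].
exists (sup E) => m; rewrite ler_norml.
have l1 : u m - e m <= sup E by apply: (ub_le_sup supE.2); exists m.
have l2 : sup E <= u m + e m by apply: (ge_sup supE.1) => _ [p ->].
by lra.
Qed.

(** Common source of the Cauchy-Schwarz inequalities for finite sums and for l^2. The homogeneous
    form in two variables avoids division by a vanishing coefficient. *)
Lemma quadratic_discriminant (F G S : R) :
  (forall x y, 0 <= x ^+ 2 * F - x * y * S *+ 2 + y ^+ 2 * G) -> S ^+ 2 <= F * G.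
Proof.
move=> quad; have G0 : 0 <= G by have := quad 0 1; lra.
have [G1|Gle] := ltrP 0 G; last first.
  have G00 : G = 0 by apply/eqP; rewrite eq_le Gle.
  (* At this point the form equals - S^2 (F + 2), which forces S = 0. *)
  have := quad S (F + 1); rewrite G00 !mulr0 addr0.
  have F0 : 0 <= F by have := quad 1 0; lra.
  by have := sqr_ge0 S; nra.
have := quad G S; rewrite (_ : _ + _ = G * (F * G - S ^+ 2)); last by ring.
by rewrite pmulr_rge0 // subr_ge0.
Qed.

Lemma sum_cauchy_schwarz (I : Type) (s : seq I) (P : pred I) (f g : I -> R) :
  (\sum_(i <- s | P i) f i * g i) ^+ 2 <=
  (\sum_(i <- s | P i) f i ^+ 2) * (\sum_(i <- s | P i) g i ^+ 2).
Proof.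
apply: quadratic_discriminant => x y; rewrite -mulrnAl !mulr_sumr -sumrB -big_split /=.
by apply: sumr_ge0 => i _; have := sqr_ge0 (x * f i - y * g i); lra.
Qed.

Lemma invS_lt (e : R) : 0 < e -> exists m : nat, m.+1%:R^-1 < e.
Proof.
move=> e0; exists (Num.truncn e^-1); rewrite invf_plt ?posrE //.
exact: truncnS_gt.
Qed.

Lemma half_exp_lt (e : R) : 0 < e -> exists m : nat, 2^-1 ^+ m < e.
Proof.
move=> /invS_lt[m me]; exists m; apply: le_lt_trans me.
rewrite exprVn lef_pV2 ?posrE ?exprn_gt0 ?ltr0Sn // -natrX ler_nat.
by rewrite ltn_expl.
Qed.

End Reals.

Section Sums.
Variables (R : realType) (T : choiceType).
Implicit Types (f g : T -> R) (A : seq T).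
Local Open Scope classical_set_scope.

Definition finite_tsum f := (\esum_(t in setT) (f t)%:E < +oo)%E.
(** [fine] sends an infinite sum to 0, so the value is informative only together with
    [finite_tsum]. *)
Definition tsum f : R := fine (\esum_(t in setT) (f t)%:E).

Lemma esumE f : (forall t, 0 <= f t) -> finite_tsum f ->
  \esum_(t in setT) (f t)%:E = (tsum f)%:E.
Proof.
move=> f0 ff; rewrite /tsum fineK // ge0_fin_numE //.
by apply: esum_ge0 => t _; rewrite lee_fin.
Qed.

Lemma sum_le_tsum f A : (forall t, 0 <= f t) -> finite_tsum f -> uniq A ->
  \sum_(t <- A) f t <= tsum f.
Proof.
move=> f0 ff uA; rewrite -lee_fin -esumE //; apply: esum_ge.
exists [set` A]; first by split=> //; exact: finite_seq.
by rewrite -sumEFin fsbig_seq.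
Qed.

Lemma tsum_le f (K : R) : (forall t, 0 <= f t) ->
  (forall A, uniq A -> \sum_(t <- A) f t <= K) ->
  finite_tsum f /\ tsum f <= K.
Proof.
move=> f0 fK; have h : (\esum_(t in setT) (f t)%:E <= K%:E)%E.
  apply: ge_ereal_sup => _ [A [finA _] <-].
  by rewrite fsbig_finite //= sumEFin lee_fin; apply: fK; exact: fset_uniq.
have ff : finite_tsum f by apply: le_lt_trans h (ltry _).
by split=> //; rewrite -lee_fin -esumE.
Qed.

Lemma tsum_ge0 f : (forall t, 0 <= f t) -> 0 <= tsum f.
Proof. by move=> f0; apply: fine_ge0; apply: esum_ge0 => t _; rewrite lee_fin. Qed.

Lemma finite_tsum_le f g : (forall t, f t <= g t) ->
  finite_tsum g -> finite_tsum f.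
Proof.
by move=> fg; apply: le_lt_trans; apply: le_esum => t _; rewrite lee_fin.
Qed.

Lemma eq_tsum f g : f =1 g -> tsum f = tsum g.
Proof. by move=> fg; congr fine; apply: eq_esum => t _; rewrite fg. Qed.

Lemma tsumD f g : (forall t, 0 <= f t) -> (forall t, 0 <= g t) ->
  finite_tsum f -> finite_tsum g ->
  finite_tsum (fun t => f t + g t) /\ tsum (fun t => f t + g t) = tsum f + tsum g.
Proof.
move=> f0 g0 ff fg.
have E : \esum_(t in setT) (f t + g t)%:E = (tsum f + tsum g)%:E.
  rewrite EFinD -!esumE // -esumD //; try by move=> t _; rewrite lee_fin.
by split; rewrite /finite_tsum /tsum E ?ltry.
Qed.

Lemma tsumZ (c : R) f : 0 <= c -> (forall t, 0 <= f t) -> finite_tsum f ->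
  finite_tsum (fun t => c * f t) /\ tsum (fun t => c * f t) = c * tsum f.
Proof.
move=> c0 f0 ff.
(* An upper bound for every constant gives equality: it is used for c and again for c^-1. *)
have le1 (d : R) g : 0 <= d -> (forall t, 0 <= g t) -> finite_tsum g ->
    finite_tsum (fun t => d * g t) /\ tsum (fun t => d * g t) <= d * tsum g.
  move=> d0 g0 fg; apply: tsum_le => [t|A uA]; first by rewrite mulr_ge0.
  by rewrite -mulr_sumr ler_wpM2l // sum_le_tsum.
have [fc lec] := le1 c f c0 f0 ff; split=> //.
have [c00|cn0] := eqVneq c 0.
  rewrite c00 mul0r; apply/eqP; rewrite eq_le tsum_ge0 ?andbT; last first.
    by move=> t; rewrite mul0r.
  by move: lec; rewrite c00 mul0r.
have cp : 0 < c by rewrite lt_def cn0.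
apply/eqP; rewrite eq_le lec /= -ler_pdivlMl //.
have cf0 t : 0 <= c * f t by rewrite mulr_ge0.
have ci0 : 0 <= c^-1 by rewrite invr_ge0.
have [_ lei] := le1 c^-1 (fun t => c * f t) ci0 cf0 fc.
by apply: le_trans lei; rewrite (@eq_tsum _ f) // => t; rewrite mulKf.
Qed.

Lemma tsum_reindex f (h k : T -> T) : cancel h k -> cancel k h ->
  tsum (fun t => f (h t)) = tsum f.
Proof.
move=> hk kh; rewrite /tsum.
rewrite (@reindex_esum R T T setT setT h (fun t => (f t)%:E)) //.
split=> //; first by move=> x y _ _; exact: (can_inj hk).
by move=> t _; exists (k t); rewrite ?kh.
Qed.

Definition abs_summable f := finite_tsum (fun t => `|f t|).

(** Any splitting into nonnegative summable parts computes [sumR], not only the canonical one,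
    because max(f, 0) + q = max(-f, 0) + p. Additivity and homogeneity follow from this. *)
Lemma sumR_diff p q f : (forall t, 0 <= p t) -> (forall t, 0 <= q t) ->
  finite_tsum p -> finite_tsum q -> (forall t, f t = p t - q t) ->
  abs_summable f /\ sumR f = tsum p - tsum q.
Proof.
move=> p0 q0 fp fq fpq.
have [fpDq _] := tsumD p0 q0 fp fq.
have af : abs_summable f.
  apply: finite_tsum_le fpDq => t; rewrite fpq ler_norml.
  by have := p0 t; have := q0 t; lra.
have fP : finite_tsum (fun t => Num.max (f t) 0).
  by apply: finite_tsum_le af => t; rewrite ge_max ler_norm normr_ge0.
have fN : finite_tsum (fun t => Num.max (- f t) 0).
  apply: finite_tsum_le af => t.
  by rewrite ge_max normr_ge0 andbT -normrN ler_norm.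
have m0 (x : R) : 0 <= Num.max x 0 by rewrite le_max lexx orbT.
split=> //; rewrite /sumR -/(tsum _) -/(tsum _).
have [_ E1] := tsumD (fun t => m0 (f t)) q0 fP fq.
have [_ E2] := tsumD (fun t => m0 (- f t)) p0 fN fp.
suff : tsum (fun t => Num.max (f t) 0 + q t)
     = tsum (fun t => Num.max (- f t) 0 + p t) by rewrite E1 E2; lra.
apply: eq_tsum => t; rewrite fpq.
by case: (leP (p t - q t) 0) => h; case: (leP (- (p t - q t)) 0) => h'; lra.
Qed.

Lemma abs_summable_parts f : abs_summable f ->
  [/\ finite_tsum (fun t => Num.max (f t) 0),
      finite_tsum (fun t => Num.max (- f t) 0)
    & forall t, f t = Num.max (f t) 0 - Num.max (- f t) 0].
Proof.
move=> af; split.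
- by apply: finite_tsum_le af => t; rewrite ge_max ler_norm normr_ge0.
- by apply: finite_tsum_le af => t; rewrite ge_max normr_ge0 andbT -normrN ler_norm.
- by move=> t; case: (leP (f t) 0) => h; case: (leP (- f t) 0) => h'; lra.
Qed.

Let max0_ge0 (x : R) : 0 <= Num.max x 0.
Proof. by rewrite le_max lexx orbT. Qed.

Lemma sumRD f g : abs_summable f -> abs_summable g ->
  sumR (fun t => f t + g t) = sumR f + sumR g.
Proof.
move=> /abs_summable_parts[fp fn fE] /abs_summable_parts[gp gn gE].
have m f' t : 0 <= Num.max (f' t : R) 0 by exact: max0_ge0.
have [P1 P2] := tsumD (m f) (m g) fp gp.
have [N1 N2] := tsumD (m (fun t => - f t)) (m (fun t => - g t)) fn gn.
have P0 t := addr_ge0 (max0_ge0 (f t)) (max0_ge0 (g t)).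
have N0 t := addr_ge0 (max0_ge0 (- f t)) (max0_ge0 (- g t)).
have [|_ ->] := sumR_diff (f := fun t => f t + g t) P0 N0 P1 N1.
  by move=> t; rewrite [f t in LHS]fE [g t in LHS]gE; lra.
by rewrite P2 N2 /sumR /tsum; lra.
Qed.

Lemma sumRN f : sumR (fun t => - f t) = - sumR f.
Proof.
by rewrite /sumR opprB; congr (_ - fine _); apply: eq_esum => t _; rewrite opprK.
Qed.

Lemma sumRZ c f : abs_summable f -> sumR (fun t => c * f t) = c * sumR f.
Proof.
wlog c0 : c / 0 <= c => [hw|] af.
  have [c0|c0] := lerP 0 c; first exact: hw.
  rewrite -[c]opprK mulNr -hw ?oppr_ge0 ?ltW // -sumRN.
  by congr sumR; apply: funext => t; rewrite mulNr.
have [fp fn fE] := abs_summable_parts af.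
have [P1 P2] := tsumZ c0 (fun t => max0_ge0 (f t)) fp.
have [N1 N2] := tsumZ c0 (fun t => max0_ge0 (- f t)) fn.
have P0 t := mulr_ge0 c0 (max0_ge0 (f t)).
have N0 t := mulr_ge0 c0 (max0_ge0 (- f t)).
have [|_ ->] := sumR_diff (f := fun t => c * f t) P0 N0 P1 N1.
  by move=> t; rewrite [f t in LHS]fE mulrBr.
by rewrite P2 N2 /sumR /tsum mulrBr.
Qed.

Lemma sumR_ge0E f : (forall t, 0 <= f t) -> finite_tsum f -> sumR f = tsum f.
Proof.
move=> f0 ff; have z0 : finite_tsum (fun _ : T => 0 : R).
  by rewrite /finite_tsum esum1 ?ltry.
have [|_ ->] := sumR_diff (f := f) f0 (fun=> lexx 0) ff z0.
  by move=> t; rewrite subr0.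
by rewrite /tsum [X in _ - fine X]esum1 //= subr0.
Qed.

Lemma sumR_reindex f (h k : T -> T) : cancel h k -> cancel k h ->
  sumR (fun t => f (h t)) = sumR f.
Proof.
move=> hk kh; rewrite /sumR; congr (_ - _).
  exact: (tsum_reindex (fun t => Num.max (f t) 0) hk kh).
exact: (tsum_reindex (fun t => Num.max (- f t) 0) hk kh).
Qed.

End Sums.

(** * The modulus of a complex number as a real number *)

Section ComplexNorm.
Variable R : realType.
Local Notation C := R[i].

Lemma ReD (z w : C) : complex.Re (z + w) = complex.Re z + complex.Re w.
Proof. by case: z w => [a b] [c d]. Qed.
Lemma ImD (z w : C) : complex.Im (z + w) = complex.Im z + complex.Im w.
Proof. by case: z w => [a b] [c d]. Qed.
Lemma ReB (z w : C) : complex.Re (z - w) = complex.Re z - complex.Re w.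
Proof. by case: z w => [a b] [c d]. Qed.
Lemma ImB (z w : C) : complex.Im (z - w) = complex.Im z - complex.Im w.
Proof. by case: z w => [a b] [c d]. Qed.

(** The norm on [R[i]] takes its values in [R[i]]; real-valued estimates need the modulus in R. *)
Definition cnorm (z : C) : R := Num.sqrt (sqnormc z).

Lemma cnormE (z : C) : `|z| = (cnorm z)%:C%C.
Proof. by rewrite normc_def. Qed.

Lemma cnorm_ge0 (z : C) : 0 <= cnorm z. Proof. exact: sqrtr_ge0. Qed.

Lemma sqr_cnorm (z : C) : cnorm z ^+ 2 = sqnormc z.
Proof. by rewrite sqr_sqrtr // sqnormc_ge0. Qed.

Lemma cnorm_le (z : C) (M : R) : (cnorm z <= M) = (`|z| <= M%:C%C).
Proof. by rewrite cnormE lecR. Qed.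

Lemma cnormD (z w : C) : cnorm (z + w) <= cnorm z + cnorm w.
Proof. by rewrite cnorm_le rmorphD /= -!cnormE ler_normD. Qed.

Lemma cnormM (z w : C) : cnorm (z * w) = cnorm z * cnorm w.
Proof. by apply: complexI; rewrite rmorphM /= -!cnormE normrM. Qed.

Lemma cnormN (z : C) : cnorm (- z) = cnorm z.
Proof. by apply: complexI; rewrite -!cnormE normrN. Qed.

Lemma cnormJ (z : C) : cnorm (z^*)%C = cnorm z.
Proof. by apply: complexI; rewrite -!cnormE normcJ. Qed.

Lemma cnorm_real (x : R) : cnorm x%:C%C = `|x|.
Proof. by rewrite /cnorm /sqnormc /= expr0n addr0 sqrtr_sqr. Qed.

Lemma sqnormcM (z w : C) : sqnormc (z * w) = sqnormc z * sqnormc w.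
Proof. by rewrite -!sqr_cnorm cnormM exprMn. Qed.

Lemma normr_Re_le (z : C) : `|complex.Re z| <= cnorm z.
Proof. by rewrite -sqrtr_sqr ler_sqrt ?sqnormc_ge0 // lerDl sqr_ge0. Qed.

Lemma normr_Im_le (z : C) : `|complex.Im z| <= cnorm z.
Proof. by rewrite -sqrtr_sqr ler_sqrt ?sqnormc_ge0 // lerDr sqr_ge0. Qed.

Lemma cnorm_le_ReIm (z : C) : cnorm z <= `|complex.Re z| + `|complex.Im z|.
Proof.
rewrite -[leRHS]ger0_norm ?addr_ge0 // -sqrtr_sqr ler_wsqrtr // /sqnormc.
have := mulr_ge0 (normr_ge0 (complex.Re z)) (normr_ge0 (complex.Im z)).
have := real_normK (num_real (complex.Re z)).
by have := real_normK (num_real (complex.Im z)); lra.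
Qed.

Lemma cnorm_eq0 (z : C) : cnorm z = 0 -> z = 0.
Proof. by move=> z0; apply/normr0_eq0; rewrite cnormE z0. Qed.

End ComplexNorm.

(** * Inner product, norm and completeness of l^2 *)

Section Ell2.
Variables (R : realType) (T : choiceType).
Local Notation C := R[i].
Local Notation H := (ell2 R T).
Implicit Types (x y z : H) (t : T) (A : seq T).

Lemma ell2_eq x y : (forall t, x t = y t) -> x = y.
Proof. by move=> xy; apply: val_inj; apply: funext. Qed.

Lemma ell2B x y t : (x - y) t = x t - y t. Proof. by []. Qed.

Let sq0 x t : 0 <= sqnormc (x t). Proof. exact: sqnormc_ge0. Qed.

Lemma ell2_finite_tsum x : finite_tsum (fun t => sqnormc (x t)).
Proof. exact: ell2P. Qed.
Hint Resolve ell2_finite_tsum : core.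

Lemma norm2_ge0 x : 0 <= norm2 x. Proof. exact: sqrtr_ge0. Qed.
Hint Resolve norm2_ge0 : core.

Lemma sqr_norm2 x : norm2 x ^+ 2 = tsum (fun t => sqnormc (x t)).
Proof. by rewrite /norm2 sqr_sqrtr // tsum_ge0. Qed.

Lemma sum_sqnormc_le x A : uniq A -> \sum_(t <- A) sqnormc (x t) <= norm2 x ^+ 2.
Proof. by move=> uA; rewrite sqr_norm2 sum_le_tsum. Qed.

Lemma norm2_le x (K : R) : 0 <= K ->
  (forall A, uniq A -> \sum_(t <- A) sqnormc (x t) <= K ^+ 2) -> norm2 x <= K.
Proof.
move=> K0 /(tsum_le (sq0 x))[_].
by rewrite -sqr_norm2 ler_pXn2r // ?nnegrE.
Qed.

Lemma cnorm_coord_le x t : cnorm (x t) <= norm2 x.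
Proof.
rewrite -(ler_pXn2r (n := 2)) ?nnegrE ?cnorm_ge0 // sqr_cnorm.
by have := @sum_sqnormc_le x [:: t] isT; rewrite big_seq1.
Qed.

Lemma norm2_eq0 x : norm2 x = 0 -> x = 0.
Proof.
move=> x0; apply: ell2_eq => t; apply: cnorm_eq0; apply/eqP.
by rewrite eq_le cnorm_ge0 andbT -x0 cnorm_coord_le.
Qed.

Lemma abs_summable_inner x y :
  abs_summable (fun t => complex.Re (x t * (y t)^*%C)) /\
  abs_summable (fun t => complex.Im (x t * (y t)^*%C)).
Proof.
have [fD _] := tsumD (sq0 x) (sq0 y) (ell2_finite_tsum x) (ell2_finite_tsum y).
have le (z w : C) : cnorm (z * w^*%C) <= sqnormc z + sqnormc w.
  rewrite cnormM cnormJ -!sqr_cnorm.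
  by have := cnorm_ge0 z; have := cnorm_ge0 w; have := sqr_ge0 (cnorm z - cnorm w); nra.
split; apply: finite_tsum_le fD => t; apply: le_trans (le (x t) (y t)).
  exact: normr_Re_le.
exact: normr_Im_le.
Qed.

Lemma abs_summableZ (f : T -> R) (c : R) :
  abs_summable f -> abs_summable (fun t => c * f t).
Proof.
move=> af; have [|fZ _] := tsumZ (normr_ge0 c) _ af; first by [].
by apply: finite_tsum_le fZ => t; rewrite normrM.
Qed.

Lemma innerC x y : inner y x = ((inner x y)^*)%C.
Proof.
rewrite /inner /sumC /= -sumRN; congr (_ +i* _)%C; congr sumR; apply: funext => t.
  by case: (x t) (y t) => [a b] [c d] /=; ring.
by case: (x t) (y t) => [a b] [c d] /=; ring.
Qed.

Lemma innerDl x y z : inner (x + y) z = inner x z + inner y z.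
Proof.
have [xr xi] := abs_summable_inner x z; have [yr yi] := abs_summable_inner y z.
rewrite /inner /sumC /=; congr (_ +i* _)%C; rewrite -sumRD //.
  by congr sumR; apply: funext => t; rewrite -ReD -mulrDl.
by congr sumR; apply: funext => t; rewrite -ImD -mulrDl.
Qed.

Lemma innerZl (c : C) x z : inner (c *: x) z = c * inner x z.
Proof.
have [xr xi] := abs_summable_inner x z.
rewrite /inner /sumC /=; case: c => [c d]; congr (_ +i* _)%C.
  rewrite -!sumRZ // -sumRN -sumRD; last 2 first.
  - exact: abs_summableZ.
  - have -> : (fun t => - (d * complex.Im (x t * (z t)^*%C)))
        = (fun t => - d * complex.Im (x t * (z t)^*%C)).
      by apply: funext => t; rewrite mulNr.
    exact: abs_summableZ.
  by congr sumR; apply: funext => t; rewrite -mulrA; case: (x t * _).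
rewrite -!sumRZ // -sumRD; try exact: abs_summableZ.
by congr sumR; apply: funext => t; rewrite -mulrA; case: (x t * _).
Qed.

Lemma innerDr x y z : inner x (y + z) = inner x y + inner x z.
Proof. by rewrite ![inner x _]innerC innerDl rmorphD. Qed.

Lemma innerZr (c : C) x z : inner x (c *: z) = c^*%C * inner x z.
Proof. by rewrite ![inner x _]innerC innerZl rmorphM. Qed.

Lemma innerBl x y z : inner (x - y) z = inner x z - inner y z.
Proof. by rewrite -scaleN1r innerDl innerZl mulN1r. Qed.

Lemma innerBr x y z : inner x (y - z) = inner x y - inner x z.
Proof. by rewrite ![inner x _]innerC innerBl rmorphB. Qed.

Lemma inner0l z : inner 0 z = 0.
Proof. by rewrite -(scale0r (0 : H)) innerZl mul0r. Qed.

Lemma inner0r z : inner z 0 = 0.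
Proof. by rewrite innerC inner0l conjc0. Qed.

Lemma innerxx x : inner x x = (norm2 x ^+ 2)%:C%C.
Proof.
rewrite sqr_norm2 /inner /sumC /=; congr (_ +i* _)%C.
  rewrite -sumR_ge0E //; congr sumR; apply: funext => t.
  by rewrite /sqnormc; case: (x t) => a b /=; ring.
suff -> : (fun t => complex.Im (x t * (x t)^*%C)) = fun=> 0.
  by rewrite /sumR oppr0 subrr.
by apply: funext => t; case: (x t) => a b /=; ring.
Qed.

Lemma norm2Z (c : C) x : norm2 (c *: x) = cnorm c * norm2 x.
Proof.
apply/eqP; rewrite -(@eqrXn2 _ 2) ?mulr_ge0 ?cnorm_ge0 // exprMn !sqr_norm2 sqr_cnorm.
have [_ <-] := tsumZ (sqnormc_ge0 c) (sq0 x) (ell2_finite_tsum x).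
by apply/eqP; apply: eq_tsum => t; rewrite -sqnormcM.
Qed.

Lemma norm2N x : norm2 (- x) = norm2 x.
Proof. by rewrite -scaleN1r norm2Z -(rmorphN1 (real_complex R)) cnorm_real normrN1 mul1r. Qed.

Lemma norm2_0 : norm2 (0 : H) = 0.
Proof.
by rewrite -(scale0r (0 : H)) norm2Z (_ : 0 = (0 : R)%:C%C) // cnorm_real normr0 mul0r.
Qed.

Lemma sqr_norm2D x y :
  norm2 (x + y) ^+ 2 = norm2 x ^+ 2 + complex.Re (inner x y) *+ 2 + norm2 y ^+ 2.
Proof.
have := innerxx (x + y); rewrite innerDl !innerDr [inner y x]innerC !innerxx.
by move/(congr1 (@complex.Re R)) => /= <-; case: (inner x y) => a b /=; ring.
Qed.

Lemma Re_inner_le x y : `|complex.Re (inner x y)| <= norm2 x * norm2 y.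
Proof.
rewrite -(ler_pXn2r (n := 2)) ?nnegrE ?mulr_ge0 // real_normK ?num_real // exprMn.
apply: quadratic_discriminant => s t.
have := sqr_ge0 (norm2 (s%:C%C *: x + (- t)%:C%C *: y)).
rewrite sqr_norm2D !norm2Z !cnorm_real innerZl innerZr !exprMn !real_normK ?num_real //.
by rewrite conjc_real; case: (inner x y) => a b /=; lra.
Qed.

(** The factor 2 comes from bounding real and imaginary parts separately; multiplying x by -i turns
    the imaginary part into a real part. *)
Lemma cnorm_inner_le x y : cnorm (inner x y) <= 2 * norm2 x * norm2 y.
Proof.
apply: le_trans (cnorm_le_ReIm _) _.
have := Re_inner_le ((0 -i* 1)%C *: x) y; rewrite innerZl norm2Z.
have -> : cnorm (0 -i* 1)%C = 1 :> R.
  by rewrite /cnorm /sqnormc /= sqrrN expr1n expr0n add0r sqrtr1.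
have -> : complex.Re ((0 -i* 1)%C * inner x y) = complex.Im (inner x y).
  by case: (inner x y) => a b /=; ring.
by have := Re_inner_le x y; lra.
Qed.

Lemma norm2D x y : norm2 (x + y) <= norm2 x + norm2 y.
Proof.
rewrite -(ler_pXn2r (n := 2)) ?nnegrE ?addr_ge0 // sqr_norm2D.
by have := Re_inner_le x y; rewrite ler_norml; lra.
Qed.

Lemma norm2B x y : norm2 (x - y) <= norm2 x + norm2 y.
Proof. by rewrite -[norm2 y]norm2N norm2D. Qed.

Lemma sqnormcD_le (z w : C) : sqnormc (z + w) <= 2 * sqnormc z + 2 * sqnormc w.
Proof.
case: z w => [a b] [c d]; rewrite /sqnormc /=.
by have := sqr_ge0 (a - c); have := sqr_ge0 (b - d); lra.
Qed.

(* The coordinatewise limit is in l^2 by Fatou's lemma for counting measure,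
   which costs the factor 2 here because the cheap bound |u+v|^2 <= 2|u|^2 + 2|v|^2
   replaces the triangle inequality. *)
Lemma ell2_complete (u : nat -> H) (e : nat -> R) :
  (forall m, 0 < e m) -> (forall d, 0 < d -> forall m, exists2 p, (m <= p)%N & e p < d) ->
  (forall m p, (m <= p)%N -> norm2 (u p - u m) <= e m) ->
  exists l : H, forall m, norm2 (l - u m) <= 2 * e m.
Proof.
move=> e0 elim ue.
have coord t : exists z : C, forall m,
    `|complex.Re (z - u m t)| <= e m /\ `|complex.Im (z - u m t)| <= e m.
  have [|lr lrP] := @cauchy_limit R (fun m => complex.Re (u m t)) e.
    move=> m p mp; rewrite -ReB -ell2B.
    exact: le_trans (normr_Re_le _) (le_trans (cnorm_coord_le _ _) (ue m p mp)).
  have [|li liP] := @cauchy_limit R (fun m => complex.Im (u m t)) e.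
    move=> m p mp; rewrite -ImB -ell2B.
    exact: le_trans (normr_Im_le _) (le_trans (cnorm_coord_le _ _) (ue m p mp)).
  by exists (lr +i* li)%C => m; rewrite ReB ImB; split; [exact: lrP | exact: liP].
have [l lP] := choice coord.
have fatou m A : uniq A -> \sum_(t <- A) sqnormc (l t - u m t) <= (2 * e m) ^+ 2.
  (* K exceeds the size of A, so coordinatewise errors of at most e m / (2 K) add up over A to no
     more than (e m)^2. *)
  move=> uA; pose K : R := (size A).+1%:R; have K0 : 0 < K by rewrite ltr0Sn.
  have d0 : 0 < e m / (2 * K) by rewrite divr_gt0 ?e0 // mulr_gt0.
  have [p mp /ltW ep] := elim _ d0 m.
  apply: (@le_trans _ _ (\sum_(t <- A)
     (2 * sqnormc (l t - u p t) + 2 * sqnormc ((u p - u m) t)))).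
    apply: ler_sum => t _; apply: le_trans (sqnormcD_le _ _).
    by rewrite ell2B addrA subrK.
  rewrite big_split /= -!mulr_sumr.
  have h1 : \sum_(t <- A) sqnormc ((u p - u m) t) <= e m ^+ 2.
    apply: le_trans (sum_sqnormc_le _ uA) _.
    by apply: lerXn2r; rewrite ?nnegrE ?norm2_ge0 ?ue // ltW.
  have h2 : \sum_(t <- A) sqnormc (l t - u p t) <= e m ^+ 2.
    apply: (@le_trans _ _ (\sum_(t <- A) 2 * (e m / (2 * K)) ^+ 2)).
      apply: ler_sum => t _; have [h h'] := lP t p.
      have sq (r : R) : `|r| <= e p -> r ^+ 2 <= (e m / (2 * K)) ^+ 2.
        move=> rp; rewrite -(real_normK (num_real r)).
        by apply: lerXn2r; rewrite ?nnegrE ?normr_ge0 ?(le_trans rp ep) // ltW.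
      by rewrite mulr_natl mulr2n; apply: lerD; apply: sq.
    rewrite big_const_seq count_predT iter_addr_0 -[leLHS]mulr_natr.
    apply: (@le_trans _ _ (2 * (e m / (2 * K)) ^+ 2 * K)).
      apply: ler_wpM2l; last by rewrite /K ler_nat.
      by apply: mulr_ge0; rewrite ?sqr_ge0.
    have -> : 2 * (e m / (2 * K)) ^+ 2 * K = e m ^+ 2 * (2 * K)^-1.
      by field; rewrite lt0r_neq0.
    rewrite ler_piMr ?sqr_ge0 // invf_le1 ?mulr_gt0 //.
    have K1 : 1 <= K by rewrite /K ler1n.
    by lra.
  by have := sqr_ge0 (e m); nra.
have lsum : l \in @sq_summable R T.
  have l0sum : (fun t => l t - u 0%N t) \in @sq_summable R T.
    by have [] := tsum_le (fun t => sqnormc_ge0 _) (fatou 0%N).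
  have -> : l = (fun t => l t - u 0%N t) + (u 0%N : T -> C).
    by apply: funext => t; rewrite /= -[RHS]/(l t - u 0%N t + u 0%N t) subrK.
  by rewrite rpredD // ell2P.
exists (Ell2 lsum) => m; apply: norm2_le => [|A uA].
  by rewrite mulr_ge0 // ltW ?e0.
exact: fatou.
Qed.

End Ell2.

(** * The group algebra acting on l^2, and square roots in C*_r(G) *)

(** Identities for the limit operator of the square-root iteration are proved by bounding their
    defect in this way. *)
Lemma le_half_exp_eq0 (R : realType) (r K : R) :
  0 <= r -> (forall m, r <= K * 2^-1 ^+ m) -> r = 0.
Proof.
move=> r0 rK; apply/eqP; rewrite eq_le r0 andbT leNgt; apply/negP => rp.
have K0 : 0 < K by have := rK 0%N; rewrite expr0 mulr1; lra.
have [m] := half_exp_lt (divr_gt0 rp K0).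
by rewrite ltr_pdivlMr // mulrC ltNge rK.
Qed.

Lemma scaler_halfD (R : realType) (V : lmodType R[i]) (v : V) :
  (2^-1 : R)%:C%C *: v + (2^-1 : R)%:C%C *: v = v.
Proof.
have h : 2^-1 + 2^-1 = 1 :> R by field.
by rewrite -scalerDl -rmorphD h scale1r.
Qed.

Section Operators.
Variables (R : realType) (T : choiceType).
Local Notation C := R[i].
Local Notation H := (ell2 R T).
Implicit Types (S : H -> H) (x y : H).

Definition bounded_by S (M : R) := forall x, norm2 (S x) <= M * norm2 x.

Lemma linear0_op S : linear S -> S 0 = 0.
Proof. by move=> lS; have := lS (-1) 0 0; rewrite scaler0 addr0 scaleN1r addNr. Qed.

Lemma linearB_op S x y : linear S -> S (x - y) = S x - S y.
Proof. by move=> lS; rewrite -[x - y]addrC -scaleN1r lS scaleN1r addrC. Qed.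

Lemma linearZ_op S (c : C) x : linear S -> S (c *: x) = c *: S x.
Proof. by move=> lS; rewrite -[c *: x]addr0 lS linear0_op // addr0. Qed.

(** For nonzero x, the supremum is tested on x divided by its norm. *)
Lemma opnorm_leP S (M : R) : linear S -> 0 <= M ->
  (opnorm S <= M%:E)%E <-> bounded_by S M.
Proof.
move=> lS M0; split=> [SM x|SM]; last first.
  apply: ge_ereal_sup => _ [x x1 <-]; rewrite lee_fin.
  by apply: le_trans (SM x) _; rewrite ler_piMr.
have [x0|xn0] := eqVneq (norm2 x) 0.
  by rewrite (norm2_eq0 x0) linear0_op // norm2_0 mulr0.
have xp : 0 < norm2 x by rewrite lt_def xn0 norm2_ge0.
have ci : cnorm ((norm2 x)^-1)%:C%C = (norm2 x)^-1.
  by rewrite cnorm_real ger0_norm // invr_ge0 norm2_ge0.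
rewrite -ler_pdivrMr // mulrC -ci -norm2Z -linearZ_op // -lee_fin.
apply: le_trans SM; apply: ereal_sup_ubound.
by exists (((norm2 x)^-1)%:C%C *: x) => //=; rewrite norm2Z ci mulVf.
Qed.

Lemma bounded_by_le S (M N : R) : M <= N -> bounded_by S M -> bounded_by S N.
Proof. by move=> MN SM x; apply: le_trans (SM x) _; rewrite ler_wpM2r ?norm2_ge0. Qed.

End Operators.

Section GroupAlgebra.
Variables (R : realType) (G : groupType).
Local Notation C := R[i].
Local Notation H := (ell2 R G).
Implicit Types (s t : seq (C * G)) (x y : H) (g h : G) (c : C).

(* The formal sum [\sum_p p.1 p.2] acting on l^2; working with lists avoids
   collecting equal group elements. *)
Definition lam s x : H := \sum_(p <- s) p.1 *: lreg p.2 x.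
Definition lext (phi : G -> C) s : C := \sum_(p <- s) p.1 * phi p.2.

Definition lscale c s := [seq (c * p.1, p.2) | p <- s].
Definition lprod s t := [seq (p.1 * q.1, (p.2 * q.2)%g) | p <- s, q <- t].
Definition lstar s := [seq ((p.1)^*%C, (p.2^-1)%g) | p <- s].

Lemma lreg_linear g c x y : lreg g (c *: x + y) = c *: lreg g x + lreg g y.
Proof. exact: ell2_eq. Qed.

Lemma lreg_mul g h x : lreg (g * h)%g x = lreg g (lreg h x).
Proof. by apply: ell2_eq => t /=; rewrite invgM mulgA. Qed.

Lemma lreg_one x : lreg 1%g x = x.
Proof. by apply: ell2_eq => t /=; rewrite invg1 mul1g. Qed.

Lemma norm2_lreg g x : norm2 (lreg g x) = norm2 x.
Proof.
congr (Num.sqrt _); rewrite /sqsum /=.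
exact: (tsum_reindex (fun h => sqnormc (x h)) (mulVKg g) (mulKg g)).
Qed.

Lemma inner_lreg g x y : inner (lreg g x) y = inner x (lreg g^-1%g y).
Proof.
have K : cancel (fun h => (g * h)%g) (fun h => (g^-1 * h)%g) by exact: mulKg.
have K' : cancel (fun h => (g^-1 * h)%g) (fun h => (g * h)%g) by exact: mulVKg.
rewrite /inner /sumC; congr (_ +i* _)%C.
  rewrite -(sumR_reindex _ K K'); congr sumR; apply: funext => t /=.
  by rewrite invgK mulKg.
rewrite -(sumR_reindex _ K K'); congr sumR; apply: funext => t /=.
by rewrite invgK mulKg.
Qed.

Lemma lam_linear s : linear (lam s).
Proof.
move=> c x y; rewrite /lam scaler_sumr -big_split; apply: eq_bigr => p _ /=.
by rewrite lreg_linear scalerDr !scalerA mulrC.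
Qed.

Lemma lam_nil x : lam [::] x = 0. Proof. by rewrite /lam big_nil. Qed.

Lemma lam_cons p s x : lam (p :: s) x = p.1 *: lreg p.2 x + lam s x.
Proof. by rewrite /lam big_cons. Qed.

Lemma lam_cat s t x : lam (s ++ t) x = lam s x + lam t x.
Proof. by rewrite /lam big_cat. Qed.

Lemma lam_scale c s x : lam (lscale c s) x = c *: lam s x.
Proof. by rewrite /lam big_map scaler_sumr; apply: eq_bigr => p _; rewrite scalerA. Qed.

Lemma lext_cat phi s t : lext phi (s ++ t) = lext phi s + lext phi t.
Proof. by rewrite /lext big_cat. Qed.

Lemma lext_scale phi c s : lext phi (lscale c s) = c * lext phi s.
Proof. by rewrite /lext big_map mulr_sumr; apply: eq_bigr => p _; rewrite mulrA. Qed.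

Lemma lam_prod s t x : lam (lprod s t) x = lam s (lam t x).
Proof.
elim: s => [|p s IH]; first by rewrite !lam_nil.
rewrite lam_cons -IH [lprod _ _]/= lam_cat; congr (_ + _).
elim: t {IH} => [|q t IH] /=.
  by rewrite !lam_nil (linear0_op (lreg_linear p.2)) scaler0.
by rewrite !lam_cons addrC -[_ *: lreg q.2 x + _]/(_ *: _ + _) lreg_linear IH lreg_mul scalerDr
  scalerA addrC.
Qed.

Lemma lam_star s : is_adjoint (lam s) (lam (lstar s)).
Proof.
move=> x y; elim: s => [|p s IH]; first by rewrite !lam_nil inner0l inner0r.
by rewrite /= !lam_cons innerDl innerDr innerZl innerZr conjcK inner_lreg IH.
Qed.

Lemma lam_bounded s : exists2 M, 0 <= M & bounded_by (lam s) M.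
Proof.
elim: s => [|p s [M M0 IH]].
  by exists 0 => // x; rewrite lam_nil norm2_0 mul0r.
exists (cnorm p.1 + M) => [|x]; first by rewrite addr_ge0 ?cnorm_ge0.
rewrite lam_cons mulrDl; apply: le_trans (norm2D _ _) _.
by rewrite norm2Z norm2_lreg lerD2l.
Qed.

(** Quantifying over the module V lets one [f] serve both the operator on l^2 and the values of
    functionals. *)
Lemma collect_terms s : exists f : group_algebra R G,
  forall (V : lmodType C) (k : G -> V),
    \sum_(g <- finsupp f) f g *: k g = \sum_(p <- s) p.1 *: k p.2.
Proof.
pose A := seq_fset tt [seq p.2 | p <- s].
pose F g := \sum_(p <- s | p.2 == g) p.1.
exists [fsfun g in A => F g] => V k; set f := [fsfun _ in _ => _].
have fE g : g \in A -> f g = F g by move=> gA; rewrite fsfunE gA.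
have -> : \sum_(g <- finsupp f) f g *: k g = \sum_(g <- A) F g *: k g.
  rewrite (big_fset_incl _ (finsupp_sub _ _ _)) /=; last first.
    by move=> g gA; rewrite memNfinsupp => /eqP ->; rewrite scale0r.
  by rewrite big_seq [RHS]big_seq; apply: eq_bigr => g /fE ->.
under eq_bigr do rewrite /F scaler_suml.
rewrite (exchange_big_dep xpredT) //= big_seq [RHS]big_seq; apply: eq_bigr => p ps.
have pA : p.2 \in A by rewrite seq_fsetE map_f.
rewrite big_mkcond (bigD1_seq _ pA (fset_uniq A)) eqxx big1 => [|g] /=.
  by rewrite addr0.
by rewrite eq_sym => /negbTE ->.
Qed.

Lemma lreg_algE (f : group_algebra R G) x :
  lreg_alg f x = \sum_(g <- finsupp f) f g *: lreg g x.
Proof. by rewrite /lreg_alg fct_sumE. Qed.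

Definition graph (f : group_algebra R G) := [seq (f g, g) | g <- finsupp f].

Lemma lam_graph f : lam (graph f) = lreg_alg f.
Proof. by apply: funext => x; rewrite lreg_algE /lam big_map. Qed.

Lemma lext_graph phi f : lext phi (graph f) = lin_ext phi f.
Proof. by rewrite /lext big_map. Qed.

Lemma lam_lreg_alg s :
  exists f, lreg_alg f = lam s /\ forall phi, lin_ext phi f = lext phi s.
Proof.
have [f fP] := collect_terms s; exists f; split=> [|phi].
  by apply: funext => x; rewrite lreg_algE (fP H).
exact: (fP C^o phi).
Qed.

Definition approximable (S : H -> H) :=
  forall e : R, 0 < e -> exists s, bounded_by (fun x => S x - lam s x) e.

Lemma linear_sub_lam S s : linear S -> linear (fun x => S x - lam s x).
Proof.
by move=> lS c x y; rewrite lS lam_linear scalerBr opprD addrACA.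
Qed.

Lemma approximable_bounded S : approximable S -> exists2 M, 0 <= M & bounded_by S M.
Proof.
move=> aS; have [s sP] := aS 1 ltr01; have [M M0 sM] := lam_bounded s.
exists (1 + M) => [|x]; first by rewrite addr_ge0.
rewrite -[S x](subrK (lam s x)) mulrDl; apply: le_trans (norm2D _ _) _.
by rewrite lerD // sP.
Qed.

Lemma Cstar_rP S : Cstar_r S <-> linear S /\ approximable S.
Proof.
split=> [[[lS _] aS]|[lS aS]].
  split=> // e e0; have [f] := aS e e0; rewrite -lam_graph => fe; exists (graph f).
  by apply/(opnorm_leP (linear_sub_lam (graph f) lS) (ltW e0)).
split.
  split=> //; have [M M0 SM] := approximable_bounded aS.
  by apply: le_lt_trans (ltry M); apply/(opnorm_leP lS M0).
move=> e e0; have [s sP] := aS e e0; have [f [fs _]] := lam_lreg_alg s.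
exists f; rewrite fs.
by apply/(opnorm_leP (linear_sub_lam s lS) (ltW e0)).
Qed.

Lemma Cstar_r_lam s : Cstar_r (lam s).
Proof.
apply/Cstar_rP; split; first exact: lam_linear.
by move=> e e0; exists s => x; rewrite subrr norm2_0 mulr_ge0 ?norm2_ge0 // ltW.
Qed.

(** * The square root of 1 - A by iteration *)

Section SquareRoot.
Variable a : seq (C * G).
Hypothesis aA : is_adjoint (lam a) (lam a).
Hypothesis aM : bounded_by (lam a) (3 / 4).

(* [Y = 1 - sqrt (1 - A)] is the fixed point of [Y |-> (A + Y^2) / 2], a contraction
   of the ball of radius 1/2 when [A] has norm at most 3/4. *)
Fixpoint sqrt_iter (m : nat) : seq (C * G) :=
  if m is m'.+1 then
    lscale (2^-1 : R)%:C%C (a ++ lprod (sqrt_iter m') (sqrt_iter m'))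
  else [::].

Let Y m := lam (sqrt_iter m).
Let half : C := (2^-1 : R)%:C%C.

Let cnorm_half : cnorm half = 2^-1.
Proof. by rewrite cnorm_real ger0_norm // invr_ge0. Qed.

Let YS m x : Y m.+1 x = half *: (lam a x + Y m (Y m x)).
Proof. by rewrite /Y /= lam_scale lam_cat lam_prod. Qed.

Let YB m x y : Y m (x - y) = Y m x - Y m y.
Proof. exact: linearB_op (lam_linear _). Qed.

(** The ball of radius 1/2 is preserved since (3/4 + 1/4) / 2 = 1/2; the bound 3/4 on A is the
    largest for which this computation closes. *)
Let Y_bounded m : bounded_by (Y m) 2^-1.
Proof.
elim: m => [|m IH] x; first by rewrite /Y lam_nil norm2_0 mulr_ge0 ?norm2_ge0 ?invr_ge0.
rewrite YS norm2Z cnorm_half; have := norm2D (lam a x) (Y m (Y m x)).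
by have := aM x; have := IH x; have := IH (Y m x); have := norm2_ge0 x; lra.
Qed.

Let Y_step m : bounded_by (fun x => Y m.+1 x - Y m x) (2^-1 ^+ m.+1).
Proof.
elim: m => [|m IH] x.
  rewrite YS /Y !lam_nil addr0 subr0 norm2Z cnorm_half expr1.
  by have := aM x; have := norm2_ge0 x; lra.
rewrite YS [Y m.+1 x in X in _ - X]YS -scalerBr norm2Z cnorm_half.
rewrite opprD addrACA subrr add0r exprS.
(* A difference of squares splits as Y' (Y' - Y) + (Y' - Y) Y. Each term gains 1/2 from the radius
   of the ball, and the prefactor 1/2 remains as the contraction rate. *)
have -> : Y m.+1 (Y m.+1 x) - Y m (Y m x)
    = Y m.+1 (Y m.+1 x - Y m x) + (Y m.+1 (Y m x) - Y m (Y m x)).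
  by rewrite YB addrA subrK.
have := norm2D (Y m.+1 (Y m.+1 x - Y m x)) (Y m.+1 (Y m x) - Y m (Y m x)).
have := Y_bounded m.+1 (Y m.+1 x - Y m x); have := IH x; have := IH (Y m x).
have : 2^-1 ^+ m.+1 * norm2 (Y m x) <= 2^-1 ^+ m.+1 * (2^-1 * norm2 x).
  by rewrite ler_wpM2l ?exprn_ge0 ?invr_ge0 ?Y_bounded.
by move: (2^-1 ^+ m.+1) => q; lra.
Qed.

Let Y_cauchy m p : (m <= p)%N ->
  bounded_by (fun x => Y p x - Y m x) (2^-1 ^+ m).
Proof.
move=> /subnKC <- x; move: (p - m)%N => k.
have : norm2 (Y (m + k)%N x - Y m x) <= (2^-1 ^+ m - 2^-1 ^+ (m + k)) * norm2 x.
  elim: k => [|k IH]; first by rewrite addn0 !subrr norm2_0 mul0r.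
  rewrite addnS -(subrK (Y (m + k)%N x) (Y _.+1 x)) -addrA.
  apply: le_trans (norm2D _ _) _; have := Y_step (m + k) x.
  by rewrite exprS; move: IH; lra.
have : 0 <= 2^-1 ^+ (m + k) :> R by rewrite exprn_ge0 ?invr_ge0.
by have := norm2_ge0 x; nra.
Qed.

Let Y_adjoint m : is_adjoint (Y m) (Y m).
Proof.
elim: m => [|m IH] x y; first by rewrite /Y !lam_nil inner0l inner0r.
by rewrite !YS innerZl innerZr conjc_real innerDl innerDr aA !IH.
Qed.

(** The limit is taken pointwise, but the rate is proportional to the norm of x, so the convergence
    is in operator norm. The factor 2 is inherited from [ell2_complete]. *)
Let Y_limit : exists Z : H -> H, forall m,
  bounded_by (fun x => Z x - Y m x) (2 * 2^-1 ^+ m).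
Proof.
have Zex x : exists l : H, forall m, norm2 (l - Y m x) <= 2 * 2^-1 ^+ m * norm2 x.
  have [x0|xn0] := eqVneq (norm2 x) 0.
    exists 0 => m; rewrite (norm2_eq0 x0) /Y (linear0_op (lam_linear _)).
    by rewrite subrr norm2_0 mulr0.
  have xp : 0 < norm2 x by rewrite lt_def xn0 norm2_ge0.
  have [|d d0 m|m p mp|l lP] := @ell2_complete R G (fun m => Y m x)
      (fun m => 2^-1 ^+ m * norm2 x).
  - by move=> m; rewrite mulr_gt0 ?exprn_gt0 ?invr_gt0.
  - have [p pd] := half_exp_lt (divr_gt0 d0 xp); exists (maxn m p); rewrite ?leq_maxl //.
    rewrite -ltr_pdivlMr //; apply: le_lt_trans pd.
    by apply: ler_wiXn2l; rewrite ?leq_maxr ?invr_ge0 // invf_le1 // ler1n.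
  - exact: Y_cauchy.
  by exists l => m; rewrite -mulrA; exact: lP.
by have [Z ZP] := choice Zex; exists Z => m x; exact: ZP.
Qed.

(** With Z the limit, S = 1 - Z. The fixed-point equation 2 Z = A + Z^2 gives S^2 = 1 - A, and
    self-adjointness passes from the iterates to Z. *)
Lemma Cstar_r_sqrt : exists S : H -> H,
  [/\ Cstar_r S, is_adjoint S S & forall x, S (S x) = x - lam a x].
Proof.
have [Z ZP] := Y_limit.

have Z_lin : linear Z.
  move=> c x y; apply/eqP; rewrite -subr_eq0; apply/eqP/norm2_eq0.
  apply: (le_half_exp_eq0 (norm2_ge0 _)) => m.
  pose K := 2 * norm2 (c *: x + y) + cnorm c * (2 * norm2 x) + 2 * norm2 y.
  suff : norm2 (Z (c *: x + y) - (c *: Z x + Z y)) <= K * 2^-1 ^+ m by exact.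
  have -> : Z (c *: x + y) - (c *: Z x + Z y)
      = (Z (c *: x + y) - Y m (c *: x + y)) - (c *: (Z x - Y m x) + (Z y - Y m y)).
    rewrite [Y m (c *: x + y)]lam_linear scalerBr.
    by rewrite [c *: _ - _ + _]addrACA -opprD opprB addrA addrNK.
  apply: le_trans (norm2B _ _) _.
  have := norm2D (c *: (Z x - Y m x)) (Z y - Y m y); rewrite norm2Z.
  have := ZP m (c *: x + y); have := ZP m y.
  by have := ler_wpM2l (cnorm_ge0 c) (ZP m x); rewrite /K; lra.
have Z_sq x : Z x + Z x = lam a x + Z (Z x).
  apply/eqP; rewrite -subr_eq0; apply/eqP/norm2_eq0.
  apply: (le_half_exp_eq0 (norm2_ge0 _)) => m.
  pose K := 3 * norm2 x + 2 * norm2 (Z x).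
  suff : norm2 (Z x + Z x - (lam a x + Z (Z x))) <= K * 2^-1 ^+ m by exact.
  (* The recursion 2 Y_{m+1} = A + Y_m^2 is subtracted, and Z^2 - Y_m^2 is written as Y_m (Z - Y_m)
     + (Z - Y_m) Z. *)
  have -> : Z x + Z x - (lam a x + Z (Z x)) = (Z x - Y m.+1 x) + (Z x - Y m.+1 x)
      - (Y m (Z x - Y m x) + (Z (Z x) - Y m (Z x))).
    rewrite addrACA -opprD YS scaler_halfD YB.
    move: (Z x + Z x) (lam a x) (Y m (Y m x)) (Y m (Z x)) (Z (Z x)) => z A b c d.
    by rewrite [c - b + _]addrC addrA subrK -addrA -opprD [d - b]addrC addrA addrK.
  have := norm2B ((Z x - Y m.+1 x) + (Z x - Y m.+1 x))
    (Y m (Z x - Y m x) + (Z (Z x) - Y m (Z x))).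
  have := norm2D (Z x - Y m.+1 x) (Z x - Y m.+1 x).
  have := norm2D (Y m (Z x - Y m x)) (Z (Z x) - Y m (Z x)).
  have := ZP m.+1 x; have := ZP m x; have := ZP m (Z x).
  by have := Y_bounded m (Z x - Y m x); rewrite exprS /K; lra.
have Z_adj : is_adjoint Z Z.
  move=> x y; apply/eqP; rewrite -subr_eq0; apply/eqP/cnorm_eq0.
  apply: (le_half_exp_eq0 (cnorm_ge0 _)) => m.
  pose K := 8 * (norm2 x * norm2 y).
  suff : cnorm (inner (Z x) y - inner x (Z y)) <= K * 2^-1 ^+ m by exact.
  have -> : inner (Z x) y - inner x (Z y)
      = inner (Z x - Y m x) y - inner x (Z y - Y m y).
    by rewrite innerBl innerBr opprB addrA Y_adjoint subrK.
  have := cnormD (inner (Z x - Y m x) y) (- inner x (Z y - Y m y)); rewrite cnormN.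
  have := cnorm_inner_le (Z x - Y m x) y; have := cnorm_inner_le x (Z y - Y m y).
  have := ler_wpM2r (norm2_ge0 y) (ZP m x); have := ler_wpM2l (norm2_ge0 x) (ZP m y).
  by rewrite /K; lra.
exists (fun x => x - Z x); split.
- apply/Cstar_rP; split.
    by move=> c x y; rewrite Z_lin scalerBr opprD addrACA.
  move=> e ep; have [|m me] := @half_exp_lt R (e / 2); first by lra.
  (* The formal sum 1 - Y_m approximates 1 - Z. *)
  exists ((1, 1%g) :: lscale (-1) (sqrt_iter m)) => x.
  rewrite lam_cons lam_scale scale1r lreg_one scaleN1r opprD addrACA subrr add0r -opprD norm2N.
  by apply: bounded_by_le (ZP m) x; lra.
- by move=> x y; rewrite innerBl innerBr Z_adj.
- move=> x; rewrite (linearB_op _ _ Z_lin) -addrA -opprD addrA Z_sq.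
  by rewrite addrK.
Qed.

End SquareRoot.

End GroupAlgebra.

(** * Extending states to C*_r(G) *)

(** The restriction [e <= 1] lets a caller build a positive parameter such as 1 - e/2. *)
Lemma le_of_le_eps (R : realType) (r A B : R) : 0 <= B ->
  (forall e, 0 < e -> e <= 1 -> r <= A + B * e) -> r <= A.
Proof.
move=> B0 h; rewrite leNgt; apply/negP => Ar.
have d0 : 0 < r - A by lra.
have B1 : 0 < 1 + B by lra.
have [m me] := invS_lt (divr_gt0 d0 B1).
have i0 : 0 < m.+1%:R^-1 :> R by rewrite invr_gt0 ltr0Sn.
have i1 : m.+1%:R^-1 <= 1 :> R by rewrite invf_le1 ?ltr0Sn // ler1n.
have := h _ i0 i1; move: me i0; rewrite ltr_pdivlMr //.
by move: (m.+1%:R^-1) => i; lra.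
Qed.

Section Extension.
Variables (R : realType) (G : groupType).
Local Notation C := R[i].
Local Notation H := (ell2 R G).
Implicit Types (s t : seq (C * G)) (x y : H) (g h : G) (c : C) (S : H -> H).

Lemma lext_cons (phi : G -> C) p s : lext phi (p :: s) = p.1 * phi p.2 + lext phi s.
Proof. by rewrite /lext big_cons. Qed.

(** Expanding t^* t over the entries of t gives exactly the sum in the definition of positive
    definiteness. *)
Lemma lext_square (phi : G -> C) t : positive_definite phi ->
  0 <= lext phi (lprod (lstar t) t).
Proof.
move=> pd; have := pd (size t) (fun i => (tnth (in_tuple t) i).2)
  (fun i => (tnth (in_tuple t) i).1).
congr (0 <= _); rewrite /lext big_allpairs_dep big_map big_tnth; apply: eq_bigr => i _.
by rewrite [RHS]big_tnth.
Qed.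

Lemma lext_star (phi : G -> C) s : (forall g, phi (g^-1)%g = (phi g)^*%C) ->
  lext phi (lstar s) = (lext phi s)^*%C.
Proof.
move=> herm; rewrite /lext big_map rmorph_sum; apply: eq_bigr => p _.
by rewrite rmorphM herm.
Qed.

(** From |D' y|^2 = <D D' y, y> <= e |D' y| |y|, divided by |D' y|. *)
Lemma adjoint_bounded (D D' : H -> H) (e : R) : 0 <= e -> is_adjoint D D' ->
  bounded_by D e -> bounded_by D' e.
Proof.
move=> e0 adj De y; have [n0|n0] := eqVneq (norm2 (D' y)) 0.
  by rewrite n0 mulr_ge0 ?norm2_ge0.
have np : 0 < norm2 (D' y) by rewrite lt_def n0 norm2_ge0.
rewrite -(ler_pM2l np) -expr2.
have := Re_inner_le (D (D' y)) y; rewrite adj innerxx /= ger0_norm ?sqr_ge0 //.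
move=> h; apply: le_trans h _; rewrite mulrCA mulrA.
by rewrite ler_wpM2r ?norm2_ge0 // De.
Qed.

Lemma approximable_lin c S S' : approximable S -> approximable S' ->
  approximable (c *: S + S').
Proof.
move=> aS aS' e e0; have k0 : 0 < cnorm c + 1 by rewrite ltr_wpDl ?cnorm_ge0.
have [t tP] := aS _ (divr_gt0 (divr_gt0 e0 k0) (ltr0Sn R 1)).
have [t' tP'] := aS' _ (divr_gt0 e0 (ltr0Sn R 1)).
exists (lscale c t ++ t') => x; rewrite lam_cat lam_scale.
have -> : (c *: S + S') x - (c *: lam t x + lam t' x)
    = c *: (S x - lam t x) + (S' x - lam t' x) by rewrite scalerBr opprD addrACA.
apply: le_trans (norm2D _ _) _; rewrite norm2Z.
have h : cnorm c * (e / (cnorm c + 1)) <= e.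
  by rewrite mulrA ler_pdivrMr //; lra.
have := ler_wpM2r (norm2_ge0 x) h; have := ler_wpM2l (cnorm_ge0 c) (tP x).
by have := tP' x; move: (e / (cnorm c + 1)) => q; lra.
Qed.

(** Positive elements are approximated by elements t^* t of the group algebra, where a positive
    definite function is nonnegative. If t is close to S, then [lstar t] is equally close to the
    adjoint S'. *)
Lemma square_approximable S S' : linear S' -> approximable S -> approximable S' ->
  is_adjoint S S' -> forall e : R, 0 < e ->
  exists t, bounded_by (fun x => S' (S x) - lam (lprod (lstar t) t) x) e.
Proof.
move=> lS' aS aS' adj e e0; have [B B0 SB] := approximable_bounded aS.
have [B' B0' SB'] := approximable_bounded aS'; pose k := B' + B + 1.
have k1 : 1 <= k by rewrite /k; lra.
(* The error is at most B' d + d (B + d), which is at most d k as d <= 1. *)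
pose d := Num.min 1 (e / k).
have d0 : 0 < d by rewrite lt_min ltr01 divr_gt0 //; lra.
have d1 : d <= 1 by rewrite ge_min lexx.
have dk : d * k <= e by rewrite -ler_pdivlMr ?ge_min ?lexx ?orbT //; lra.
have [t tP] := aS d d0; exists t => x; rewrite lam_prod.
have tP' : bounded_by (fun x => S' x - lam (lstar t) x) d.
  apply: (adjoint_bounded (ltW d0) _ tP) => u v.
  by rewrite innerBl innerBr adj lam_star.
have -> : S' (S x) - lam (lstar t) (lam t x)
    = S' (S x - lam t x) + (S' (lam t x) - lam (lstar t) (lam t x)).
  by rewrite (linearB_op _ _ lS') addrA subrK.
apply: le_trans (norm2D _ _) _.
have h1 : norm2 (lam t x) <= (B + d) * norm2 x.
  rewrite -[lam t x](subKr (S x)); apply: le_trans (norm2B _ _) _.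
  by have := tP x; have := SB x; lra.
have := ler_wpM2l B0' (tP x); have := SB' (S x - lam t x); have := tP' (lam t x).
have := ler_wpM2l (ltW d0) h1; have := norm2_ge0 x.
have : d * k * norm2 x <= e * norm2 x by rewrite ler_wpM2r ?norm2_ge0.
have : d * d * norm2 x <= d * norm2 x by rewrite ler_wpM2r ?norm2_ge0 // ler_piMr // ltW.
by rewrite /k; lra.
Qed.

(** * Extension of a bounded state by continuity *)

Section BoundedState.
Variables (phi : G -> C) (K : R).
Hypothesis phi_state : is_state phi.
Hypothesis K0 : 0 <= K.
Hypothesis phiK : forall s (M : R), bounded_by (lam s) M -> cnorm (lext phi s) <= K * M.

(** Characterises the value at S by its distance to all group algebra elements at once, so that no
    approximating sequence has to be fixed. *)
Definition extension_value S (z : C) := forall s (M : R),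
  bounded_by (fun x => S x - lam s x) M -> cnorm (z - lext phi s) <= K * M.

Lemma lextB_le s t (M : R) : bounded_by (fun x => lam s x - lam t x) M ->
  cnorm (lext phi s - lext phi t) <= K * M.
Proof.
move=> stM; rewrite -mulN1r -lext_scale -lext_cat; apply: phiK => x.
by rewrite lam_cat lam_scale scaleN1r.
Qed.

Lemma bounded_by_sub_lam S s t (M N : R) :
  bounded_by (fun x => S x - lam s x) M -> bounded_by (fun x => S x - lam t x) N ->
  bounded_by (fun x => lam s x - lam t x) (M + N).
Proof.
move=> sM tN x; rewrite mulrDl.
have -> : lam s x - lam t x = (S x - lam t x) - (S x - lam s x).
  by rewrite opprB [RHS]addrC addrA subrK.
by apply: le_trans (norm2B _ _) _; rewrite addrC; apply: lerD; [exact: sM | exact: tN].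
Qed.

Lemma extension_value_ex S : approximable S -> exists z, extension_value S z.
Proof.
move=> aS; have i0 (m : nat) : 0 < m.+1%:R^-1 :> R by rewrite invr_gt0 ltr0Sn.
have [t tP] := choice (fun m => aS _ (i0 m)).
pose e m := 2 * K * m.+1%:R^-1.
have ce m p : (m <= p)%N -> cnorm (lext phi (t p) - lext phi (t m)) <= e m.
  move=> mp; apply: le_trans (lextB_le (bounded_by_sub_lam (tP p) (tP m))) _.
  rewrite /e [2 * K]mulrC -mulrA ler_wpM2l // mulr_natl mulr2n lerD2r.
  by rewrite lef_pV2 ?posrE ?ltr0Sn // ler_nat.
have [|a aP] := @cauchy_limit R (fun m => complex.Re (lext phi (t m))) e.
  by move=> m p /ce; apply: le_trans; rewrite -ReB normr_Re_le.
have [|b bP] := @cauchy_limit R (fun m => complex.Im (lext phi (t m))) e.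
  by move=> m p /ce; apply: le_trans; rewrite -ImB normr_Im_le.
(* Real and imaginary part each contribute an error 2 K d, and comparing t m with s contributes K
   d. *)
exists (a +i* b)%C => s M sM; apply: (@le_of_le_eps _ _ _ (5 * K)).
  by rewrite mulr_ge0.
move=> d d0 _; have [m md] := invS_lt d0.
rewrite -(subrK (lext phi (t m)) (a +i* b)%C) -addrA; apply: le_trans (cnormD _ _) _.
have := cnorm_le_ReIm ((a +i* b)%C - lext phi (t m)); rewrite ReB ImB /=.
have := aP m; have := bP m; have := lextB_le (bounded_by_sub_lam (tP m) sM).
by have := ler_wpM2l K0 (ltW md); rewrite /e; move: (m.+1%:R^-1) => i; lra.
Qed.

Lemma extension_value_uniq S z z' : approximable S ->
  extension_value S z -> extension_value S z' -> z = z'.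
Proof.
move=> aS zP zP'; apply/eqP; rewrite -subr_eq0; apply/eqP/cnorm_eq0/eqP.
rewrite eq_le cnorm_ge0 andbT; apply: (@le_of_le_eps _ _ _ (2 * K)).
  by rewrite mulr_ge0.
move=> e e0 _; have [s sP] := aS e e0.
rewrite -(subrK (lext phi s) z) -addrA -[lext phi s - z']opprB.
apply: le_trans (cnormD _ _) _; rewrite cnormN.
by have := zP s e sP; have := zP' s e sP; lra.
Qed.

Lemma extension_value_lin c S S' z z' : approximable S -> approximable S' ->
  extension_value S z -> extension_value S' z' ->
  extension_value (c *: S + S') (c * z + z').
Proof.
move=> aS aS' zP zP' s M sM.
apply: (@le_of_le_eps _ _ _ (2 * K * (cnorm c + 1))).
  by rewrite !mulr_ge0 ?addr_ge0 ?cnorm_ge0.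
move=> e e0 _; have [t tP] := aS e e0; have [t' tP'] := aS' e e0.
have tM : bounded_by (fun x => (c *: S + S') x - lam (lscale c t ++ t') x)
    ((cnorm c + 1) * e).
  move=> x; rewrite lam_cat lam_scale.
  have -> : (c *: S + S') x - (c *: lam t x + lam t' x)
      = c *: (S x - lam t x) + (S' x - lam t' x) by rewrite scalerBr opprD addrACA.
  apply: le_trans (norm2D _ _) _; rewrite norm2Z.
  by have := ler_wpM2l (cnorm_ge0 c) (tP x); have := tP' x; lra.
have := lextB_le (bounded_by_sub_lam tM sM); rewrite lext_cat lext_scale => h.
have -> : c * z + z' - lext phi s = c * (z - lext phi t) + (z' - lext phi t')
    + (c * lext phi t + lext phi t' - lext phi s) by ring.
apply: le_trans (cnormD _ _) _; have := cnormD (c * (z - lext phi t)) (z' - lext phi t').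
have := ler_wpM2l (cnorm_ge0 c) (zP t e tP); have := zP' t' e tP'; rewrite cnormM.
by move: h; lra.
Qed.

(** The default 0 is harmless: a positive functional is constrained only on C*_r(G), where a value
    exists. *)
Definition extension S : C := xget 0 [set z | extension_value S z]%classic.

Lemma extensionP S : approximable S -> extension_value S (extension S).
Proof. by move=> /extension_value_ex[z zP]; exact: (xgetPex 0 (ex_intro _ z zP)). Qed.

Lemma reduced_state_of_bounded : reduced_state phi.
Proof.
split=> //; exists extension; split; last first.
  move=> f; rewrite -lam_graph -lext_graph.
  have [_ af] := (Cstar_rP _).1 (Cstar_r_lam (graph f)).
  apply: (extension_value_uniq af (extensionP af)) => s M; exact: lextB_le.
split=> [c S S' /Cstar_rP[_ aS] /Cstar_rP[_ aS']|S S' /Cstar_rP[lS aS] /Cstar_rP[lS' aS'] adj].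
  have aSS := approximable_lin c aS aS'; apply: (extension_value_uniq aSS).
    exact: extensionP.
  by apply: extension_value_lin => //; exact: extensionP.
have sq := square_approximable lS' aS aS' adj.
have aSS : approximable (S' \o S).
  by move=> e /sq[t tP]; exists (lprod (lstar t) t).
have zP := extensionP aSS; move: (extension _) zP => z zP.
(* The value z lies within K e of some phi(t^* t) >= 0, which bounds the negative part of Re z and
   the size of Im z. *)
have near (e : R) : 0 < e -> - complex.Re z <= 0 + K * e /\ `|complex.Im z| <= 0 + K * e.
  move=> /sq[t /zP]; have := lext_square t phi_state.1; move: (lext _ _) => w w0 zw.
  have := normr_Re_le (z - w); have := normr_Im_le (z - w).
  rewrite ReB ImB (ger0_Im w0) subr0 add0r => hI; rewrite ler_norml => hR.
  move: w0; rewrite lecE /= => /andP[_ w0].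
  by split; lra.
(* The equation Im z = 0 becomes |Im z| <= 0, so that both components are inequalities to be proved
   up to epsilon. *)
rewrite lecE /= -[X in X && _]negbK -normr_gt0 -leNgt; apply/andP; split.
  by apply: (le_of_le_eps K0) => e e0 _; have [] := near e e0.
by rewrite -oppr_le0; apply: (le_of_le_eps K0) => e e0 _; have [] := near e e0.
Qed.

End BoundedState.

Lemma reduced_state_selfadjoint_le (phi : G -> C) s (M : R) : reduced_state phi ->
  is_adjoint (lam s) (lam s) -> 0 < M -> bounded_by (lam s) M ->
  complex.Re (lext phi s) <= 4 / 3 * M.
Proof.
move=> [[_ phi1] [tau [[_ tau_pos] tauE]]] sA M0 sM.
have tauL t : tau (lam t) = lext phi t.
  by have [f [<- fE]] := lam_lreg_alg t; rewrite tauE fE.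
pose k : R := 3 / 4 / M; pose a := lscale k%:C%C s.
have k0 : 0 < k by rewrite !divr_gt0.
have aA : is_adjoint (lam a) (lam a).
  by move=> x y; rewrite !lam_scale innerZl innerZr conjc_real sA.
have aM : bounded_by (lam a) (3 / 4).
  move=> x; rewrite lam_scale norm2Z cnorm_real gtr0_norm //.
  apply: le_trans (ler_wpM2l (ltW k0) (sM x)) _.
  by rewrite mulrA /k divfK ?gt_eqF.
have [S [CS SA SS]] := Cstar_r_sqrt aA aM.
have := tau_pos S S CS CS SA.
have -> : S \o S = lam ((1, 1%g) :: lscale (-1) a).
  apply: funext => x /=.
  by rewrite SS lam_cons lam_scale scale1r lreg_one scaleN1r.
rewrite tauL lext_cons lext_scale lext_scale phi1 mulr1 lecE /=.
case: (lext phi s) => u v /= /andP[_] h.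
have -> : 4 / 3 * M = k^-1 * 1 by rewrite /k; field; rewrite gt_eqF.
by rewrite ler_pdivlMl //; lra.
Qed.

Lemma reduced_state_le (phi : G -> C) : (forall g, phi (g^-1)%g = (phi g)^*%C) ->
  reduced_state phi -> forall s (M : R), 0 < M -> bounded_by (lam s) M ->
  cnorm (lext phi s) <= 3 * M.
Proof.
move=> herm red.
have star_bounded t (M : R) : 0 < M -> bounded_by (lam t) M -> bounded_by (lam (lstar t)) M.
  by move=> M0; apply: adjoint_bounded (ltW M0) (@lam_star _ _ t).
have ReM t (M : R) : 0 < M -> bounded_by (lam t) M -> complex.Re (lext phi t) <= 4 / 3 * M.
  move=> M0 tM; pose a := lscale (2^-1 : R)%:C%C (t ++ lstar t).
  have aA : is_adjoint (lam a) (lam a).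
    move=> x y; rewrite !lam_scale !lam_cat innerZl innerZr conjc_real innerDl innerDr.
    rewrite lam_star addrC; congr (_ * (_ + _)).
    by rewrite innerC -lam_star -innerC.
  have aM : bounded_by (lam a) M.
    move=> x; rewrite lam_scale lam_cat norm2Z cnorm_real ger0_norm ?invr_ge0 //.
    have := norm2D (lam t x) (lam (lstar t) x); have := tM x.
    by have := star_bounded t M M0 tM x; lra.
  have := reduced_state_selfadjoint_le red aA M0 aM.
  rewrite lext_scale lext_cat lext_star //; case: (lext phi t) => u v /=.
  by rewrite mul0r subr0; lra.
have absM t (M : R) : 0 < M -> bounded_by (lam t) M -> `|complex.Re (lext phi t)| <= 4 / 3 * M.
  move=> M0 tM; have := ReM t M M0 tM; have := ReM (lscale (-1) t) M M0 _.
  rewrite lext_scale ler_norml; case: (lext phi t) => u v /= h h'.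
  suff : bounded_by (lam (lscale (-1) t)) M by move=> /h; lra.
  by move=> x; rewrite lam_scale scaleN1r norm2N.
move=> s M M0 sM; have h1 := absM s M M0 sM.
have := absM (lscale (0 +i* 1)%C s) M M0 _; rewrite lext_scale => h2.
have /h2 : bounded_by (lam (lscale (0 +i* 1)%C s)) M.
  move=> x; rewrite lam_scale norm2Z (_ : cnorm _ = 1) ?mul1r //.
  by rewrite /cnorm /sqnormc /= expr0n expr1n add0r sqrtr1.
move: h1 (cnorm_le_ReIm (lext phi s)); case: (lext phi s) => u v /=.
by rewrite mul0r mul1r sub0r normrN; lra.
Qed.

Lemma sum_delta1_le (A : seq G) : uniq A ->
  \sum_(g <- A) sqnormc ((g == 1%g)%:R : C) <= 1.
Proof.
move=> uA; have [in1|nin1] := boolP (1%g \in A).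
  rewrite (bigD1_seq _ in1 uA) /= eqxx big1 => [|g /negbTE ->].
    by rewrite addr0 /sqnormc /= expr1n expr0n addr0.
  by rewrite /sqnormc /= expr0n addr0.
rewrite big_seq big1 => [|g gA]; first exact: ler01.
have /negbTE -> : g != 1%g by apply: contraNneq nin1 => <-.
by rewrite /sqnormc /= expr0n addr0.
Qed.

Lemma delta1_sq_summable : (fun g : G => (g == 1%g)%:R : C) \in @sq_summable R G.
Proof. by have [] := tsum_le (fun=> sqnormc_ge0 _) sum_delta1_le. Qed.

Lemma bounded_by_ge0 S (M : R) : bounded_by S M -> 0 <= M.
Proof.
move=> SM; pose d : H := Ell2 delta1_sq_summable.
have d0 : 0 < norm2 d.
  apply: lt_le_trans (cnorm_coord_le d 1%g).
  by rewrite /= eqxx (cnorm_real (1 : R)) normr1.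
by rewrite -(pmulr_lge0 _ d0); exact: le_trans (norm2_ge0 _) (SM d).
Qed.

Lemma lext_le_of_square_summable (phi : G -> C) (K : R) : 0 <= K ->
  (forall A : seq G, uniq A -> \sum_(g <- A) sqnormc (phi g) <= K ^+ 2) ->
  forall s (M : R), bounded_by (lam s) M -> cnorm (lext phi s) <= K * M.
Proof.
move=> K0 phiK s M sM; pose d : H := Ell2 delta1_sq_summable.
pose A := undup [seq p.2 | p <- s]; have uA : uniq A := undup_uniq _.
(* The image of the unit vector at 1 lists the coefficients of s, with repeated group elements
   collected. *)
have dE g : lam s d g = \sum_(p <- s | p.2 == g) p.1.
  have -> : lam s d g = \sum_(p <- s) p.1 * (p.2^-1 * g == 1)%g%:R.
    by elim: {+}s => [|p t IH]; rewrite ?lam_nil ?big_nil // lam_cons big_cons -IH.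
  rewrite [RHS]big_mkcond; apply: eq_bigr => p _.
  have -> : (p.2^-1 * g == 1)%g = (p.2 == g).
    by apply/eqP/eqP => [h|->]; rewrite ?mulVg // -[g](mulVKg p.2) h mulg1.
  by case: eqP => _; rewrite ?mulr1 ?mulr0.
have -> : lext phi s = \sum_(g <- A) lam s d g * phi g.
  under [RHS]eq_bigr do rewrite dE mulr_suml.
  rewrite (exchange_big_dep xpredT) //= /lext big_seq [RHS]big_seq.
  apply: eq_bigr => p ps; have pA : p.2 \in A by rewrite mem_undup map_f.
  rewrite big_mkcond (bigD1_seq _ pA uA) eqxx big1 => [|g] /=; first by rewrite addr0.
  by rewrite eq_sym => /negbTE ->.
have d1 : norm2 d <= 1.
  by apply: norm2_le => // B uB; rewrite expr1n; exact: sum_delta1_le.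
have le1 : cnorm (\sum_(g <- A) lam s d g * phi g)
    <= \sum_(g <- A) cnorm (lam s d g) * cnorm (phi g).
  elim: (A) => [|g B IH]; first by rewrite !big_nil (cnorm_real (0 : R)) normr0.
  by rewrite !big_cons; apply: le_trans (cnormD _ _) _; rewrite cnormM lerD2l.
apply: le_trans le1 _; have M0 := bounded_by_ge0 sM.
rewrite -(ler_pXn2r (n := 2)) ?nnegrE ?mulr_ge0 ?sumr_ge0 //; last first.
  by move=> g _; rewrite mulr_ge0 ?cnorm_ge0.
apply: le_trans (sum_cauchy_schwarz _ _ _ _) _; rewrite exprMn mulrC.
apply: ler_pM; rewrite ?sumr_ge0 //; try by move=> g _; exact: sqr_ge0.
  by under eq_bigr do rewrite sqr_cnorm; exact: phiK.
under eq_bigr do rewrite sqr_cnorm; apply: le_trans (sum_sqnormc_le _ uA) _.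
apply: lerXn2r; rewrite ?nnegrE ?norm2_ge0 //; apply: le_trans (sM d) _.
by rewrite ler_piMr.
Qed.

End Extension.

(** * Positive definiteness of psi *)

Section WordFunction.
Variables (R : realType) (n : nat) (a b : R).
Local Notation letter := (letter n).
Implicit Types (v w x y : seq letter) (l : letter).

(** [psi] read from left to right: a pair u_i^{-1} u_j is consumed at once for b, any other letter
    costs a. This form exposes multiplicativity under concatenation. *)
Fixpoint wpsi w : R :=
  match w with
  | [::] => 1
  | l :: v => if l.2 then a * wpsi v else
      match v with
      | [::] => a
      | l' :: v' => if l'.2 then b * wpsi v' else a * wpsi v
      end
  end.

Lemma wpsi_pos l v : l.2 -> wpsi (l :: v) = a * wpsi v.
Proof. by move=> /= ->. Qed.

(** The default [false] counts the empty word among those that do not begin with a positive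
    letter. *)
Lemma wpsi_neg l v : ~~ l.2 -> ~~ head false [seq p.2 | p <- v] ->
  wpsi (l :: v) = a * wpsi v.
Proof. by move=> /= /negbTE ->; case: v => [|l' v] /=; rewrite ?mulr1 // => /negbTE ->. Qed.

Lemma wpsi_neg_pos l l' v : ~~ l.2 -> l'.2 -> wpsi [:: l, l' & v] = b * wpsi v.
Proof. by move=> /= /negbTE -> ->. Qed.

Lemma word_ind2 (P : seq letter -> Prop) :
  P [::] -> (forall l v, l.2 -> P v -> P (l :: v)) ->
  (forall l v, ~~ l.2 -> ~~ head false [seq p.2 | p <- v] -> P v -> P (l :: v)) ->
  (forall l l' v, ~~ l.2 -> l'.2 -> P v -> P [:: l, l' & v]) -> forall w, P w.
Proof.
move=> P0 Ppos Pneg Pnp w; have [m] := ubnP (size w).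
elim: m w => // m IH [|l v] // sv; have [lp|ln] := boolP l.2.
  by apply: Ppos => //; exact: IH.
case: v sv => [|l' v] sv; first by apply: Pneg.
have [lp'|ln'] := boolP l'.2; last by apply: Pneg => //; exact: IH.
by apply: Pnp => //; apply: IH; exact: ltnW.
Qed.

Lemma psiE (s : free_group n) : psi a b s = (wpsi s)%:C%C.
Proof.
rewrite /psi /gamma; congr (_%:C)%C; move: (word s) => {s} w.
pose p := fun p : letter * letter => ~~ p.1.2 && p.2.2.
rewrite -/p; pose gam w := count p (zip w (behead w)).
have gcons l l' v : gam [:: l, l' & v] = (~~ l.2 && l'.2 + gam (l' :: v))%N by [].
have gpos l v : l.2 -> gam (l :: v) = gam v.
  by case: v => // l' v lp; rewrite gcons lp.
have gneg l v : ~~ l.2 -> ~~ head false [seq q.2 | q <- v] -> gam (l :: v) = gam v.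
  by case: v => // l' v _ /= /negbTE lp; rewrite gcons lp andbF.
rewrite -/(gam w).
(* The bound on [gam] is carried along to keep the truncated subtraction exact. *)
suff [] : (2 * gam w <= size w)%N /\ a ^+ (size w - 2 * gam w) * b ^+ gam w = wpsi w by [].
elim/word_ind2: w => [|l v lp [le E]|l v ln hv [le E]|l l' v ln lp [le E]].
- by rewrite /= !expr0 mulr1.
- rewrite wpsi_pos // gpos //; split; first exact: leqW.
  by rewrite /= subSn // exprS -mulrA E.
- rewrite wpsi_neg // gneg //; split; first exact: leqW.
  by rewrite /= subSn // exprS -mulrA E.
- rewrite wpsi_neg_pos // gcons ln lp gpos // mulnDr muln1; split.
    by rewrite /=; lia.
  rewrite -E /= (_ : (size v).+2 - (2 + 2 * gam v) = size v - 2 * gam v)%N; last by lia.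
  by rewrite exprS mulrCA.
Qed.

(** Multiplicativity can fail only when the cut falls inside a pair u_i^{-1} u_j; the defaults make
    it hold for empty words. *)
Lemma wpsi_cat x y : last true [seq p.2 | p <- x] || ~~ head false [seq p.2 | p <- y] ->
  wpsi (x ++ y) = wpsi x * wpsi y.
Proof.
elim/word_ind2: x => [|l v lp IH|l v ln hv IH|l l' v ln lp IH] h.
- by rewrite mul1r.
- rewrite cat_cons !wpsi_pos // IH ?mulrA //.
  by move: h => /=; rewrite lp.
- rewrite cat_cons !wpsi_neg //; last first.
    by case: v hv h {IH} => //= _; rewrite (negbTE ln).
  rewrite IH ?mulrA //; case: v hv h {IH} => //=.
- rewrite !cat_cons !wpsi_neg_pos // IH ?mulrA //.
  by move: h => /=; rewrite lp.
Qed.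

Lemma word_inv_cons l v : word_inv (l :: v) = rcons (word_inv v) (inv_letter l).
Proof. by rewrite /word_inv /= rev_cons. Qed.

(** Inversion maps a pair u_i^{-1} u_j to u_j^{-1} u_i, again negative followed by positive. *)
Lemma wpsi_inv w : wpsi (word_inv w) = wpsi w.
Proof.
elim/word_ind2: w => [|l v lp IH|l v ln hv IH|l l' v ln lp IH] //.
- rewrite word_inv_cons -cats1 wpsi_cat /= lp ?orbT //.
  by rewrite IH mulrC.
- rewrite word_inv_cons -cats1 wpsi_cat; last first.
    case: v hv {IH} => //= l' v ln'; rewrite word_inv_cons map_rcons last_rcons.
    by rewrite /= ln'.
  by rewrite IH [RHS]wpsi_neg // [wpsi [:: _]]wpsi_pos // mulr1 mulrC.
- rewrite !word_inv_cons -!cats1 -catA wpsi_cat /= ?lp ?orbT //.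
  by rewrite ln IH (negbTE ln) /= mulr1 mulrC.
Qed.

Definition wker v w := wpsi (word_mul (word_inv v) w).

Lemma wker_nil w : wker [::] w = wpsi w. Proof. by []. Qed.

Lemma word_inv_mul v w : reduced_word v -> reduced_word w ->
  word_inv (word_mul v w) = word_mul (word_inv w) (word_inv v).
Proof.
move=> rv rw; pose g := FreeGroup rv; pose h := FreeGroup rw.
exact: (congr1 (@word n) (invgM g h)).
Qed.

Lemma wker_sym v w : reduced_word v -> reduced_word w -> wker v w = wker w v.
Proof.
move=> rv rw; rewrite /wker -wpsi_inv word_inv_mul ?word_invK //.
exact: reduced_inv.
Qed.

Lemma wkerxx v : wker v v = 1.
Proof. by rewrite /wker word_mulV. Qed.

Lemma reduced_consP l v : reduced_word (l :: v) =
  (if v is l' :: _ then l' != inv_letter l else true) && reduced_word v.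
Proof. by case: v. Qed.

Lemma push_reduced l v : reduced_word (l :: v) -> push l v = l :: v.
Proof. by case: v => //= l' v /andP[/negbTE ->]. Qed.

Lemma wker_cons l v w : reduced_word (l :: v) -> reduced_word (l :: w) ->
  wker (l :: v) (l :: w) = wker v w.
Proof.
move=> rv rw; rewrite /wker word_inv_cons -cats1 /word_mul foldr_cat /=.
by rewrite inv_letterK eqxx.
Qed.

Lemma word_mul_cat v w : reduced_word (v ++ w) -> word_mul v w = v ++ w.
Proof.
elim: v => //= l v IH rvw; rewrite IH; last exact: path_sorted rvw.
exact: push_reduced.
Qed.

Lemma reduced_rcons_cat v l w : reduced_word (rcons v l) -> reduced_word (l :: w) ->
  reduced_word (rcons v l ++ w).
Proof.
case: v => //= l' v rv rw.
by rewrite /reduced_word /= cat_path last_rcons; apply/andP; split.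
Qed.

(** Left translation by l moves the pair (v, l^{-1}) to (l v, 1). *)
Lemma wker_consl l v : reduced_word (l :: v) ->
  wker v [:: inv_letter l] = wpsi (l :: v).
Proof.
move=> rv; have := reduced_inv rv; rewrite word_inv_cons -cats1 => riv.
by rewrite -[RHS]wpsi_inv /wker word_mul_cat // word_inv_cons cats1.
Qed.

Lemma wker_neq l l' v w : reduced_word (l :: v) -> reduced_word (l' :: w) -> l' != l ->
  wker (l :: v) (l' :: w) = wpsi (word_inv v ++ [:: inv_letter l, l' & w]).
Proof.
move=> rv rw ll'; have := reduced_inv rv; rewrite /wker word_inv_cons => riv.
rewrite word_mul_cat ?cat_rcons // -cat_rcons; apply: reduced_rcons_cat => //.
by rewrite reduced_consP inv_letterK ll'.
Qed.

(* Seen from the vertex l, the cut vertex separating the words starting with l from the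
   other words: l itself if l is positive, the root if l is negative. *)
Definition gate l : seq letter := if l.2 then [::] else [:: inv_letter l].

(** The component of v at the vertex u_i of the root block: the kernel between u_i and v when v lies
    behind u_i, and 0 otherwise. *)
Definition pos_part (i : 'I_n) v : R :=
  if v is l :: v' then (l == (i, true))%:R * wpsi v' else 0.

(** The kernel inside the branch of l after removal of the component along the gate, that is, a
    Schur complement. *)
Definition tail_kernel l v w : R :=
  if (ohead v == Some l) && (ohead w == Some l) then
    wker (behead v) (behead w) - wker (behead v) (gate l) * wker (behead w) (gate l)
  else 0.

Lemma tail_kernel_sum k (e : bool) v w :
  \sum_(i < n) (tail_kernel (i, true) ((k, e) :: v) w
    + tail_kernel (i, false) ((k, e) :: v) w) = tail_kernel (k, e) ((k, e) :: v) w.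
Proof.
have z l : l != (k, e) -> tail_kernel l ((k, e) :: v) w = 0.
  by move=> lk; rewrite /tail_kernel /= (_ : Some (k, e) == Some l = false) //;
    apply: contraNF lk => /eqP[->].
rewrite (bigD1 k) //= big1 ?addr0 => [|i ik].
  case: e z => z.
    by rewrite [X in _ + X = _]z ?addr0 // xpair_eqE andbF.
  by rewrite [X in X + _ = _]z ?add0r // xpair_eqE andbF.
by rewrite !z ?addr0 // xpair_eqE negb_and ik.
Qed.

Lemma pos_part_sum k (e : bool) v :
  \sum_(i < n) pos_part i ((k, e) :: v) = e%:R * wpsi v.
Proof.
rewrite (bigD1 k) //= big1 ?addr0 => [|i ik]; first by rewrite xpair_eqE eqxx eqb_id.
by rewrite xpair_eqE eq_sym (negbTE ik) mul0r.
Qed.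

Lemma pos_part_prod l l' v w :
  \sum_(i < n) pos_part i (l :: v) * pos_part i (l' :: w)
  = (l.2 && (l' == l))%:R * (wpsi v * wpsi w).
Proof.
case: l l' => [k e] [k' e']; rewrite (bigD1 k) //= big1 ?addr0 => [|i ik].
  by rewrite !xpair_eqE eqxx; case: e e' (k' == k) => [] [] [] /=;
    rewrite ?(mul0r, mul1r, mulr0).
by rewrite xpair_eqE eq_sym (negbTE ik) !mul0r.
Qed.

(* The words form a tree of blocks {g, g u_1, ..., g u_n}, any two of which share at
   most one vertex, and wker is multiplicative across the cut vertices. *)
Lemma wker_decomposition v w : reduced_word v -> reduced_word w ->
  wker v w = wpsi v * wpsi w
    + \sum_(i < n) (tail_kernel (i, true) v w + tail_kernel (i, false) v w)
    + (b - a ^+ 2) * ((\sum_(i < n) pos_part i v) * (\sum_(i < n) pos_part i w))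
    + (1 - b) * \sum_(i < n) pos_part i v * pos_part i w.
Proof.
case: v => [|[i e] v].
  move=> _ rw; rewrite wker_nil /= mul1r big1 => [|k _]; last exact: addr0.
  by rewrite big1_eq mul0r mulr0 big1 ?mulr0 ?addr0 // => k _; rewrite mul0r.
case: w => [|[j f] w] rv rw.
  rewrite wker_sym // wker_nil tail_kernel_sum /tail_kernel andbF /= mulr1 addr0.
  by rewrite big1_eq !mulr0 addr0 big1 ?mulr0 ?addr0 // => k _; rewrite mulr0.
rewrite tail_kernel_sum !pos_part_sum pos_part_prod.
have rv' : reduced_word v by move: rv; rewrite reduced_consP => /andP[].
(* Same first letter: for a positive one, the coefficients a^2, b - a^2 and 1 - b add up to 1 and
   restore the product removed in [tail_kernel]; for a negative one the gate term is already wpsi v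
   * wpsi w. *)
have [E|ne] := eqVneq (j, f) (i, e).
  move: rw; rewrite E => rw; have rw' : reduced_word w.
    by move: rw; rewrite reduced_consP => /andP[].
  have -> : tail_kernel (i, e) ((i, e) :: v) ((i, e) :: w)
      = wker v w - wker v (gate (i, e)) * wker w (gate (i, e)).
    by rewrite /tail_kernel /= eqxx.
  case: E => _ ->; rewrite wker_cons // andbT /gate; case: e rv rw => rv rw.
    by rewrite !(wker_sym _ (w := [::])) // !wker_nil !wpsi_pos //=; ring.
  by rewrite !wker_consl //=; ring.
rewrite wker_neq //.
rewrite [tail_kernel _ _ _](_ : _ = 0); last first.
  rewrite /tail_kernel /= (_ : Some (j, f) == _ = false) ?andbF //.
  by apply: contraNF ne => /eqP[-> ->].
rewrite andbF mul0r mulr0 !addr0.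
(* Two distinct positive letters meet in a pair u_i^{-1} u_j, which costs b = a^2 + (b - a^2). In
   all other cases the root separates the words and the kernel is a product. *)
have [/andP[et ft]|nef] := boolP (e && f).
  rewrite wpsi_cat /= ?et ?orbT //= ft wpsi_inv.
  by rewrite mulr1n; ring.
rewrite -cat_rcons -word_inv_cons wpsi_cat ?wpsi_inv.
  by case: (e) (f) nef => [] [] //= _; rewrite ?(mul0r, mulr0) addr0.
rewrite word_inv_cons map_rcons last_rcons /=.
by case: (e) (f) nef => [] [].
Qed.

Definition wform (ps : seq (R * seq letter)) : R :=
  \sum_(p <- ps) \sum_(q <- ps) p.1 * q.1 * wker p.2 q.2.

Lemma sqr_sumE (T : Type) (s : seq T) (f : T -> R) :
  \sum_(p <- s) \sum_(q <- s) f p * f q = (\sum_(p <- s) f p) ^+ 2.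
Proof.
rewrite expr2 mulr_suml; apply: eq_bigr => p _; rewrite mulr_sumr.
by [].
Qed.

Definition tails l (ps : seq (R * seq letter)) :=
  [seq (p.1, behead p.2) | p <- ps & ohead p.2 == Some l].

Definition words_ok N (ps : seq (R * seq letter)) :=
  all (fun p => reduced_word p.2 && (size p.2 <= N)%N) ps.

Lemma tail_form l ps :
  \sum_(p <- ps) \sum_(q <- ps) p.1 * q.1 * tail_kernel l p.2 q.2
  = wform (tails l ps) - (\sum_(p <- tails l ps) p.1 * wker p.2 (gate l)) ^+ 2.
Proof.
rewrite -sqr_sumE /wform -sumrB big_map big_filter [RHS]big_mkcond.
apply: eq_bigr => p _; case: ifP => hp; last first.
  by apply: big1 => q _; rewrite /tail_kernel hp mulr0.
rewrite -sumrB big_map big_filter [RHS]big_mkcond; apply: eq_bigr => q _.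
by rewrite /tail_kernel hp /=; case: ifP => _; rewrite ?mulr0 //=; ring.
Qed.

Lemma wform_decomposition N ps : words_ok N ps ->
  wform ps = (\sum_(p <- ps) p.1 * wpsi p.2) ^+ 2
    + \sum_(i < n) (\sum_(e <- [:: true; false]) (wform (tails (i, e) ps)
        - (\sum_(p <- tails (i, e) ps) p.1 * wker p.2 (gate (i, e))) ^+ 2))
    + (b - a ^+ 2) * (\sum_(i < n) \sum_(p <- ps) p.1 * pos_part i p.2) ^+ 2
    + (1 - b) * \sum_(i < n) (\sum_(p <- ps) p.1 * pos_part i p.2) ^+ 2.
Proof.
move=> /allP ok.
have okr p : p \in ps -> reduced_word p.2 by move=> /ok/andP[].
have -> : wform ps = \sum_(p <- ps) \sum_(q <- ps)
    ((p.1 * wpsi p.2) * (q.1 * wpsi q.2)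
    + \sum_(i < n) (p.1 * q.1 * tail_kernel (i, true) p.2 q.2
                     + p.1 * q.1 * tail_kernel (i, false) p.2 q.2)
    + (b - a ^+ 2) * ((\sum_(i < n) p.1 * pos_part i p.2)
                       * (\sum_(i < n) q.1 * pos_part i q.2))
    + (1 - b) * \sum_(i < n) (p.1 * pos_part i p.2) * (q.1 * pos_part i q.2)).
  rewrite /wform big_seq [RHS]big_seq; apply: eq_bigr => p pp.
  rewrite big_seq [RHS]big_seq; apply: eq_bigr => q qq.
  rewrite wker_decomposition ?okr // -!mulr_sumr.
  under [in RHS]eq_bigr do rewrite -mulrDr.
  under [in X in _ = _ + (1 - b) * X]eq_bigr do rewrite mulrACA.
  by rewrite -!mulr_sumr; ring.
under eq_bigr do rewrite !big_split /=.
rewrite !big_split /=; congr (_ + _ + _ + _).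
- exact: sqr_sumE.
- under eq_bigr do rewrite exchange_big /=.
  rewrite exchange_big /=; apply: eq_bigr => i _.
  rewrite big_cons big_seq1 -!tail_form -big_split /=; apply: eq_bigr => p _.
  by rewrite -big_split.
- under eq_bigr do rewrite -mulr_sumr.
  rewrite -mulr_sumr sqr_sumE; congr (_ * _ ^+ 2).
  by rewrite exchange_big.
- under eq_bigr do rewrite -mulr_sumr.
  rewrite -mulr_sumr; congr (_ * _); under [LHS]eq_bigr do rewrite exchange_big /=.
  by rewrite exchange_big /=; apply: eq_bigr => i _; exact: sqr_sumE.
Qed.

Section Positivity.
Hypotheses (a1 : a ^+ 2 <= 1) (b1 : b <= 1) (ab : n%:R * a ^+ 2 - 1 <= (n%:R - 1) * b).

Lemma wform_cons (c : R) w ps : reduced_word w -> all (fun p => reduced_word p.2) ps ->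
  wform ((c, w) :: ps)
  = c ^+ 2 + c * (\sum_(p <- ps) p.1 * wker p.2 w) *+ 2 + wform ps.
Proof.
move=> rw /allP rps; set t := \sum_(p <- ps) _.
have E1 : \sum_(q <- ps) c * q.1 * wker w q.2 = c * t.
  rewrite mulr_sumr big_seq [RHS]big_seq; apply: eq_bigr => p pp.
  by rewrite wker_sym ?rps // mulrA.
have E2 : \sum_(p <- ps) p.1 * c * wker p.2 w = c * t.
  by rewrite mulr_sumr; apply: eq_bigr => p _; rewrite mulrA [c * _]mulrC.
rewrite /wform big_cons big_cons /= wkerxx E1.
under [X in _ + _ + X = _]eq_bigr do rewrite big_cons /=.
by rewrite big_split /= E2; ring.
Qed.

(** The branch terms are nonnegative by Cauchy-Schwarz against the gate. What remains is the Schur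
    complement (b - a^2) J + (1 - b) I of the root block, J the all-ones matrix: its eigenvalues are
    1 - b and, on constants, 1 - n a^2 + (n - 1) b. *)
Lemma wform_step N :
  (forall l ps, words_ok N ps ->
     (\sum_(p <- ps) p.1 * wker p.2 (gate l)) ^+ 2 <= wform ps) ->
  forall ps, words_ok N.+1 ps -> 0 <= wform ps.
Proof.
move=> IH ps ok; rewrite (wform_decomposition ok).
have tails_ok l : words_ok N (tails l ps).
  apply/allP => _ /mapP[[c w] + ->]; rewrite mem_filter => /andP[/eqP hw wps] /=.
  move/allP: ok => /(_ _ wps) /=; case: w hw {wps} => //= l' w _ /andP[rw sw].
  by rewrite -ltnS sw andbT; apply: path_sorted rw.
pose C i := \sum_(p <- ps) p.1 * pos_part i p.2.
pose S2 := \sum_(i < n) C i ^+ 2; pose S1 := \sum_(i < n) C i.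
have cs : S1 ^+ 2 <= n%:R * S2.
  have := sum_cauchy_schwarz (index_enum 'I_n) xpredT (fun=> 1) C.
  under eq_bigr do rewrite mul1r; rewrite expr1n sumr_const card_ord.
  by [].
have S20 : 0 <= S2 by apply: sumr_ge0 => i _; exact: sqr_ge0.
have T0 : 0 <= \sum_(i < n) (\sum_(e <- [:: true; false]) (wform (tails (i, e) ps)
        - (\sum_(p <- tails (i, e) ps) p.1 * wker p.2 (gate (i, e))) ^+ 2)).
  by apply: sumr_ge0 => i _; apply: sumr_ge0 => e _; rewrite subr_ge0 IH.
have key : 0 <= (b - a ^+ 2) * S1 ^+ 2 + (1 - b) * S2.
  (* Only for b < a^2 is S1^2 <= n S2 needed, and then the lower bound on b enters. *)
  have [ba|/ltW ba] := lerP (a ^+ 2) b.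
    by rewrite addr_ge0 // mulr_ge0 ?sqr_ge0 ?subr_ge0.
  have := ab; move: ba cs; rewrite -subr_ge0 -[_ <= n%:R * _]subr_ge0 => ba cs.
  rewrite -subr_ge0 => ab0; have := mulr_ge0 ba cs; have := mulr_ge0 S20 ab0.
  by move: (S1) (S2) => s1 s2; lra.
by rewrite -addrA; exact: addr_ge0 (addr_ge0 (sqr_ge0 _) T0) key.
Qed.

(** Cauchy-Schwarz and positivity alternate: the inequality for length N gives positivity for length
    N + 1. Adjoining the gate, a word of length at most 1, with coefficient -t turns the form into
    wform ps - t^2, which is the inequality for N + 1. *)
Lemma wform_gate N l ps : words_ok N ps ->
  (\sum_(p <- ps) p.1 * wker p.2 (gate l)) ^+ 2 <= wform ps.
Proof.
elim: N l ps => [|N IH] l ps ok.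
  have E p : p \in ps -> p.2 = [::].
    by move/allP: ok => ok /ok /andP[_]; rewrite leqn0 size_eq0 => /eqP.
  have -> : wform ps = (\sum_(p <- ps) p.1) ^+ 2.
    rewrite -sqr_sumE /wform big_seq [RHS]big_seq; apply: eq_bigr => p pp.
    rewrite big_seq [RHS]big_seq; apply: eq_bigr => q qq.
    by rewrite (E p) ?(E q) // wkerxx mulr1.
  have -> : \sum_(p <- ps) p.1 * wker p.2 (gate l) = wpsi (gate l) * \sum_(p <- ps) p.1.
    rewrite mulr_sumr big_seq [RHS]big_seq; apply: eq_bigr => p pp.
    by rewrite (E p) // wker_nil mulrC.
  rewrite exprMn ler_piMl ?sqr_ge0 // /gate.
  by case: l => i [] /=; rewrite ?expr1n // mulr1.
have rps : all (fun p => reduced_word p.2) ps by apply: sub_all ok => p /andP[].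
have rg : reduced_word (gate l) by rewrite /gate; case: ifP.
set t := \sum_(p <- ps) _.
have := wform_step IH (ps := (- t, gate l) :: ps).
rewrite wform_cons // -/t => h; rewrite -subr_ge0.
have {h} : 0 <= (- t) ^+ 2 + - t * t *+ 2 + wform ps.
  apply: h; apply/andP; split; last exact: ok.
  by rewrite /= rg /gate; case: ifP.
by lra.
Qed.

Lemma wform_ge0 ps : all (fun p => reduced_word p.2) ps -> 0 <= wform ps.
Proof.
move=> rps; pose N := \max_(p <- ps) size p.2.
apply: (@wform_step N); first exact: wform_gate.
apply/allP => p pp; rewrite (allP rps _ pp) /=.
by apply: leqW; exact: (leq_bigmax_seq (F := fun p : R * seq letter => size p.2)).
Qed.

End Positivity.

Lemma psi_state : a ^+ 2 <= 1 -> b <= 1 -> n%:R * a ^+ 2 - 1 <= (n%:R - 1) * b ->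
  is_state (@psi n R a b).
Proof.
move=> a1 b1 ab; split; last by rewrite psiE.
move=> k g c; pose ps (f : R[i] -> R) := [seq (f (c i), word (g i)) | i <- enum 'I_k].
have Q0 f : 0 <= wform (ps f).
  by apply: wform_ge0 => //; apply/allP => _ /mapP[i _ ->]; exact: word_reduced.
have Qsum (f : R[i] -> R) : wform (ps f)
    = \sum_i \sum_j f (c i) * f (c j) * wker (g i) (g j).
  by rewrite /wform big_map big_enum; apply: eq_bigr => i _; rewrite big_map big_enum.
suff -> : \sum_i \sum_j (c i)^*%C * c j * psi a b ((g i)^-1 * g j)%g
    = (wform (ps (@complex.Re R)) + wform (ps (@complex.Im R)))%:C%C.
  by rewrite ler0c addr_ge0.
pose A := \sum_i \sum_j complex.Re (c i) * complex.Im (c j) * wker (g i) (g j).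
have A_sym : A = \sum_i \sum_j complex.Im (c i) * complex.Re (c j) * wker (g i) (g j).
  rewrite /A exchange_big; apply: eq_bigr => i _; apply: eq_bigr => j _.
  by rewrite [_ * complex.Im _]mulrC wker_sym ?word_reduced.
(* The mixed sum A is added and subtracted; symmetry of the kernel rewrites one copy with Re and Im
   exchanged, after which both sides agree term by term. *)
have -> : (wform (ps (@complex.Re R)) + wform (ps (@complex.Im R)))%:C%C
    = (wform (ps (@complex.Re R)))%:C%C + (wform (ps (@complex.Im R)))%:C%C
      + 'i%C * A%:C%C - 'i%C * A%:C%C by rewrite addrK rmorphD.
rewrite {2}A_sym /A !Qsum !rmorph_sum /= !mulr_sumr -!sumrN -!big_split /=.
apply: eq_bigr => i _.
rewrite !rmorph_sum /= !mulr_sumr -!sumrN -!big_split /=; apply: eq_bigr => j _.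
have -> : psi a b ((g i)^-1 * g j)%g = (wker (g i) (g j))%:C%C by rewrite psiE.
case: (c i) (c j) (wker _ _) => [x y] [z t] w; apply/eqP; rewrite eq_complex /=.
by apply/andP; split; apply/eqP; ring.
Qed.

Lemma psi_herm (s : free_group n) : psi a b (s^-1)%g = (psi a b s)^*%C.
Proof. by rewrite !psiE conjc_real wpsi_inv. Qed.

End WordFunction.

(** * Haagerup's inequality *)

Section CommonPrefix.
Variable n : nat.
Local Notation letter := (letter n).
Implicit Types (v w q : seq letter) (l : letter).

Fixpoint lcp v w : nat :=
  match v, w with
  | c :: v', d :: w' => if c == d then (lcp v' w').+1 else 0
  | _, _ => 0
  end.

Lemma lcpP v w : exists q v' w', [/\ v = q ++ v', w = q ++ w', size q = lcp v w
  & if (v', w') is (c :: _, d :: _) then c != d else true].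
Proof.
elim: v w => [|c v IH] [|d w]; try by exists [::]; do 2!eexists; split.
rewrite /=; case: eqVneq => [<-|cd]; last by exists [::], (c :: v), (d :: w).
have [q [v' [w' [-> -> <- h]]]] := IH w.
by exists (c :: q), v', w'.
Qed.

Lemma word_mul_inv_cat q v w : reduced_word (q ++ w) ->
  word_mul (word_inv (q ++ v)) (q ++ w) = word_mul (word_inv v) w.
Proof.
elim: q => //= l q IH r; rewrite word_inv_cons -cats1 /word_mul foldr_cat /=.
rewrite inv_letterK eqxx; apply: IH; exact: path_sorted r.
Qed.

(** Cancellation in v^{-1} w removes exactly the common prefix. *)
Lemma word_inv_mulE v w : reduced_word v -> reduced_word w ->
  word_mul (word_inv v) w = word_inv (drop (lcp v w) v) ++ drop (lcp v w) w.
Proof.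
move=> rv rw; have [q [v' [w' [Ev Ew <- h]]]] := lcpP v w.
rewrite Ev Ew !drop_size_cat // word_mul_inv_cat -?Ew //.
have rv' : reduced_word v' by move: rv; rewrite Ev => /cat_sorted2[].
have rw' : reduced_word w' by move: rw; rewrite Ew => /cat_sorted2[].
rewrite word_mul_cat //; case: v' w' h rv' rw' {Ev Ew} => [|c v'] [|d w'] // cd rv' rw'.
  by rewrite cats0 reduced_inv.
rewrite word_inv_cons cat_rcons -cat_rcons; apply: reduced_rcons_cat => //.
  by rewrite -word_inv_cons reduced_inv.
by rewrite reduced_consP inv_letterK eq_sym cd.
Qed.

Lemma take_lcp v w : take (lcp v w) v = take (lcp v w) w.
Proof. by have [q [v' [w' [-> -> <- _]]]] := lcpP v w; rewrite !take_size_cat. Qed.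

Lemma lcp_le v w : (lcp v w <= size v)%N.
Proof. by have [q [v' [w' [-> _ <- _]]]] := lcpP v w; rewrite size_cat leq_addr. Qed.

End CommonPrefix.

Section Haagerup.
Variables (R : realType) (n : nat).
Local Notation C := R[i].
Local Notation G := (free_group n).
Local Notation H := (ell2 R G).

Lemma sqnormc_sum_le (I : Type) (s : seq I) (P : pred I) (f : I -> R) (z : I -> C) :
  sqnormc (\sum_(i <- s | P i) (f i)%:C%C * z i)
  <= (\sum_(i <- s | P i) f i ^+ 2) * (\sum_(i <- s | P i) sqnormc (z i)).
Proof.
have -> : \sum_(i <- s | P i) (f i)%:C%C * z i
    = ((\sum_(i <- s | P i) f i * complex.Re (z i))
       +i* (\sum_(i <- s | P i) f i * complex.Im (z i)))%C.
  elim/big_rec3: _ => [|i x y t _ ->]; first by [].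
  by case: (z i) => u v; apply/eqP; rewrite eq_complex /= !mul0r subr0 addr0 !eqxx.
rewrite /sqnormc /= big_split /= mulrDr.
by apply: lerD; exact: sum_cauchy_schwarz.
Qed.

Variables (k : nat) (A : seq G) (f : G -> R).
Hypotheses (uA : uniq A) (sA : forall s, s \in A -> size s = k).

Definition sphere_elt := [seq ((f s)%:C%C, s) | s <- A].

Let F2 := \sum_(s <- A) f s ^+ 2.

Let cut (p : nat) (q : seq (letter n)) := \sum_(s <- A | take p (word s) == q) f s ^+ 2.

Lemma sum_cut_le p (U : seq (seq (letter n))) : uniq U -> \sum_(q <- U) cut p q <= F2.
Proof.
move=> uU; rewrite /cut (exchange_big_dep xpredT) //=; apply: ler_sum => s _.
rewrite big_mkcond; have [inU|ninU] := boolP (take p (word s) \in U).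
  rewrite (bigD1_seq _ inU uU) eqxx big1 ?addr0 => [|q] /=; first by rewrite addr0.
  by rewrite eq_sym => /negbTE ->.
rewrite big_seq big1 ?sqr_ge0 // => q qU; case: eqP => // E.
by rewrite E qU in ninU.
Qed.

(** With the prefix q fixed, (g, s) is recovered from s^{-1} g: this word is the inverse of the tail
    of s followed by the tail of g, and the tail of s has the known length k - p. So every
    coordinate of x occurs at most once. *)
Lemma sum_fibre_le p (B : seq G) (x : H) q : uniq B ->
  \sum_(g <- B | take p (word g) == q) \sum_(s <- A | lcp (word s) (word g) == p) sqnormc (x (s^-1 * g)%g)
  <= norm2 x ^+ 2.
Proof.
move=> uB; pose P := [seq g <- B | take p (word g) == q].
pose Q g := [seq s <- A | lcp (word s) (word g) == p].
have -> : \sum_(g <- B | take p (word g) == q) \sum_(s <- A | lcp (word s) (word g) == p)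
      sqnormc (x (s^-1 * g)%g)
    = \sum_(h <- [seq (s^-1 * g)%g | g <- P, s <- Q g]) sqnormc (x h).
  rewrite big_allpairs_dep -[LHS]big_filter; apply: eq_bigr => g _.
  by rewrite -[LHS]big_filter.
apply: sum_sqnormc_le; apply: allpairs_uniq_dep; first exact: filter_uniq.
  by move=> g _; exact: filter_uniq.
move=> _ _ /allpairsPdep[g [s [gP sQ ->]]] /allpairsPdep[g' [s' [gP' sQ' ->]]] /= E.
have split_word g1 s1 : g1 \in P -> s1 \in Q g1 ->
    [/\ word s1 = q ++ drop p s1, word g1 = q ++ drop p g1, size (drop p s1) = (k - p)%N
    & word (s1^-1 * g1)%g = word_inv (drop p s1) ++ drop p g1].
  rewrite !mem_filter => /andP[/eqP tg _] /andP[/eqP lp sA1].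
  split; rewrite ?size_drop ?sA //.
  - by rewrite -tg -{1}lp -take_lcp lp cat_take_drop.
  - by rewrite -tg cat_take_drop.
  - by have := word_inv_mulE (word_reduced s1) (word_reduced g1); rewrite lp.
have [Es Eg ss Ew] := split_word g s gP sQ.
have [Es' Eg' ss' Ew'] := split_word g' s' gP' sQ'.
have sz v : size (word_inv v) = size v :> nat by rewrite size_rev size_map.
have /eqP := congr1 (@word n) E; rewrite Ew Ew' eqseq_cat ?sz ?ss //.
move=> /andP[/eqP/(can_inj (@word_invK n)) E1 /eqP E2].
have -> : g' = g by apply: val_inj; rewrite /= Eg Eg' E2.
have -> : s' = s by apply: val_inj; rewrite /= Es Es' E1.
by [].
Qed.

(** The sum is split by the length p of the prefix shared by s and g. Cauchy-Schwarz over the k + 1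
    values of p costs one factor k + 1 in the square, adding up the k + 1 slices costs the other. In
    a slice, Cauchy-Schwarz over s decouples f, cut by prefixes, from x, summed over fibres. *)
Lemma haagerup_inequality : bounded_by (lam sphere_elt) (k.+1%:R * Num.sqrt F2).
Proof.
have F20 : 0 <= F2 by apply: sumr_ge0 => s _; exact: sqr_ge0.
move=> x; apply: norm2_le => [|B uB]; first by rewrite !mulr_ge0 ?sqrtr_ge0 ?norm2_ge0.
(* The coefficient 1 puts the outer sum in the form of [sqnormc_sum_le], whose first factor is then
   k + 1. *)
have lamE g : lam sphere_elt x g
    = \sum_(p < k.+1) (1 : R)%:C%C * \sum_(s <- A | lcp (word s) (word g) == p) (f s)%:C%C * x (s^-1 * g)%g.
  have -> : lam sphere_elt x g = \sum_(s <- A) (f s)%:C%C * x (s^-1 * g)%g.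
    rewrite /sphere_elt; elim: (A) => [|s A' IH]; first by rewrite lam_nil big_nil.
    by rewrite /= lam_cons big_cons -IH.
  under [RHS]eq_bigr do rewrite mul1r.
  rewrite (exchange_big_dep xpredT) //= big_seq [RHS]big_seq; apply: eq_bigr => s sA'.
  have lk : (lcp (word s) (word g) < k.+1)%N by rewrite ltnS -(sA sA') lcp_le.
  by rewrite (big_pred1 (Ordinal lk)) // => p; rewrite /= -val_eqE eq_sym.
pose X p (g : G) := \sum_(s <- A | lcp (word s) (word g) == p) sqnormc (x (s^-1 * g)%g).
have X0 p g : 0 <= X p g by apply: sumr_ge0 => s _; exact: sqnormc_ge0.
have cut0 p q : 0 <= cut p q by apply: sumr_ge0 => s _; exact: sqr_ge0.
have step g : sqnormc (lam sphere_elt x g)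
    <= k.+1%:R * \sum_(p < k.+1) cut p (take p (word g)) * X p g.
  rewrite lamE; apply: le_trans (sqnormc_sum_le _ _ _ _) _.
  rewrite expr1n sumr_const card_ord ler_wpM2l //; apply: ler_sum => p _.
  apply: le_trans (sqnormc_sum_le _ _ _ _) _; apply: ler_wpM2r; first exact: X0.
  rewrite /cut big_mkcond [leRHS]big_mkcond; apply: ler_sum => s _.
  case: eqP => [<-|_]; first by rewrite take_lcp eqxx.
  by case: ifP => _; rewrite ?sqr_ge0.
have slice (p : 'I_k.+1) : \sum_(g <- B) cut p (take p (word g)) * X p g <= F2 * norm2 x ^+ 2.
  pose U := undup [seq take p (word g) | g <- B].
  apply: (@le_trans _ _ (\sum_(q <- U) cut p q * \sum_(g <- B | take p (word g) == q) X p g)).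
    under [leRHS]eq_bigr do rewrite mulr_sumr.
    rewrite (exchange_big_dep xpredT) //= big_seq [leRHS]big_seq; apply: ler_sum => g gB.
    have inU : take p (word g) \in U by rewrite mem_undup; apply/mapP; exists g.
    rewrite big_mkcond (bigD1_seq _ inU (undup_uniq _)) eqxx /= lerDl.
    by apply: sumr_ge0 => q _; case: ifP => // _; rewrite mulr_ge0.
  apply: (@le_trans _ _ (\sum_(q <- U) cut p q * norm2 x ^+ 2)).
    by apply: ler_sum => q _; rewrite ler_wpM2l // sum_fibre_le.
  by rewrite -mulr_suml ler_wpM2r ?sqr_ge0 // sum_cut_le // undup_uniq.
apply: (@le_trans _ _ (k.+1%:R * \sum_(p < k.+1) F2 * norm2 x ^+ 2)).
  apply: (@le_trans _ _ (k.+1%:R * \sum_(p < k.+1) \sum_(g <- B) cut p (take p (word g)) * X p g)).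
    by rewrite exchange_big /= mulr_sumr; apply: ler_sum => g _; exact: step.
  by rewrite ler_wpM2l //; apply: ler_sum => p _; exact: slice.
rewrite sumr_const card_ord !exprMn (sqr_sqrtr F20) -[F2 * _ *+ _]mulr_natl.
by rewrite [X in _ <= X * _ * _]expr2 !mulrA.
Qed.

End Haagerup.

(** * Growth of psi on spheres *)

Section Spheres.
Variables (R : realType) (n : nat).
Local Notation letter := (letter n).
Implicit Types (v w : seq letter) (l : letter).

Definition letters : seq letter := [seq (i, e) | i <- enum 'I_n, e <- [:: true; false]].

Fixpoint sphere k : seq (seq letter) :=
  if k is k'.+1 then
    [seq l :: v | l <- letters, v <- [seq v <- sphere k' | reduced_word (l :: v)]]
  else [:: [::]].

Lemma mem_letters l : l \in letters.
Proof. by case: l => i e; apply/allpairsP; exists (i, e); rewrite mem_enum; case: e. Qed.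

Lemma mem_sphere k w : (w \in sphere k) = reduced_word w && (size w == k).
Proof.
elim: k w => [|k IH] w; first by rewrite inE; case: w => [|l w]; rewrite ?andbF.
apply/allpairsPdep/andP => [[l [v [_ + ->]]]|].
  by rewrite mem_filter IH => /and3P[-> _ /eqP <-].
case: w => [[]|l v [rv sv]] //; exists l, v; split=> //; first exact: mem_letters.
rewrite mem_filter rv IH -eqSS -[(size v).+1]/(size (l :: v)) sv andbT.
exact: path_sorted rv.
Qed.

Lemma uniq_sphere k : uniq (sphere k).
Proof.
elim: k => //= k IH; apply: allpairs_uniq_dep => [|l _|].
- by apply: allpairs_uniq; rewrite ?enum_uniq // => -[i e] [j f] _ _ [-> ->].
- exact: filter_uniq.
- by move=> [l v] [l' v'] _ _ /= [-> ->].
Qed.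

Definition gsphere k : seq (free_group n) := pmap insub (sphere k).

Lemma map_gsphere k : [seq word g | g <- gsphere k] = sphere k.
Proof.
rewrite /gsphere (pmap_filter (@insubK _ _ (free_group n))).
apply/all_filterP/allP => w; rewrite mem_sphere => /andP[rw _].
by rewrite insubT.
Qed.

Lemma mem_gsphere k g : (g \in gsphere k) = (size g == k).
Proof.
rewrite -(mem_map (f := @word n)); last exact: val_inj.
by rewrite map_gsphere mem_sphere word_reduced.
Qed.

Lemma uniq_gsphere k : uniq (gsphere k).
Proof. by rewrite -(map_inj_uniq (f := @word n)) ?map_gsphere ?uniq_sphere //; exact: val_inj. Qed.

Lemma sum_gsphere k (F : seq letter -> R) :
  \sum_(g <- gsphere k) F (word g) = \sum_(w <- sphere k) F w.
Proof. by rewrite -map_gsphere big_map. Qed.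

Lemma sum_sphereS k (F : seq letter -> R) :
  \sum_(w <- sphere k.+1) F w
  = \sum_(i < n) \sum_(v <- sphere k | reduced_word ((i, true) :: v)) F ((i, true) :: v)
  + \sum_(i < n) \sum_(v <- sphere k | reduced_word ((i, false) :: v)) F ((i, false) :: v).
Proof.
rewrite big_allpairs_dep big_allpairs_dep big_enum -big_split /=; apply: eq_bigr => i _.
by rewrite !big_cons big_nil addr0 !big_filter.
Qed.

(** The indicators record that the next letter may have any index if the sign is kept, and must
    differ from i if the sign changes. *)
Lemma sum_sphere_cons k i e (F : seq letter -> R) :
  \sum_(v <- sphere k.+1 | reduced_word ((i, e) :: v)) F v
  = \sum_(j < n) (e || (j != i))%:R *
      \sum_(v <- sphere k | reduced_word ((j, true) :: v)) F ((j, true) :: v)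
  + \sum_(j < n) (~~ e || (j != i))%:R *
      \sum_(v <- sphere k | reduced_word ((j, false) :: v)) F ((j, false) :: v).
Proof.
rewrite big_mkcond sum_sphereS; congr (_ + _); apply: eq_bigr => j _;
  rewrite mulr_sumr; apply: eq_bigr => v rv;
  rewrite reduced_consP rv andbT /inv_letter xpair_eqE /=;
  by case: e (j == i) => [] []; rewrite ?mul1r ?mul0r.
Qed.

Lemma sum_neq (j : 'I_n) : \sum_(i < n) (j != i)%:R = n%:R - 1 :> R.
Proof.
have : \sum_(i < n) (1 : R) = n%:R by rewrite sumr_const card_ord.
rewrite (bigD1 j) //= => <-; rewrite addrC addrK (bigD1 j) //= eqxx add0r.
by apply: eq_bigr => i; rewrite eq_sym => ->.
Qed.

(** * A two-component recursion for the sphere sums *)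

Variables a b : R.
Local Notation f := (wpsi a b).

Definition level k := \sum_(w <- sphere k) f w ^+ 2.
(** The leading u_i is left out of the summand. A preceding u_i^{-1} would absorb it at the price b
    instead of a, so this quantity closes the recursion without dividing by a. By contrast,
    [level_neg k] concerns words of length k + 1. *)
Definition below_pos k :=
  \sum_(i < n) \sum_(v <- sphere k | reduced_word ((i, true) :: v)) f v ^+ 2.
Definition level_neg k :=
  \sum_(i < n) \sum_(v <- sphere k | reduced_word ((i, false) :: v)) f ((i, false) :: v) ^+ 2.

Lemma levelS k : level k.+1 = a ^+ 2 * below_pos k + level_neg k.
Proof.
rewrite /level sum_sphereS; congr (_ + _); rewrite mulr_sumr; apply: eq_bigr => i _.
by rewrite mulr_sumr; apply: eq_bigr => v _; rewrite wpsi_pos // exprMn.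
Qed.

Lemma below_posS k : below_pos k.+1 = n%:R * a ^+ 2 * below_pos k + (n%:R - 1) * level_neg k.
Proof.
rewrite /below_pos.
have -> : \sum_(i < n) \sum_(v <- sphere k.+1 | reduced_word ((i, true) :: v)) f v ^+ 2
    = \sum_(i < n) (a ^+ 2 * below_pos k + \sum_(j < n) (j != i)%:R *
        \sum_(v <- sphere k | reduced_word ((j, false) :: v)) f ((j, false) :: v) ^+ 2).
  apply: eq_bigr => i _; rewrite sum_sphere_cons; congr (_ + _).
  rewrite mulr_sumr; apply: eq_bigr => j _; rewrite mul1r mulr_sumr.
  by apply: eq_bigr => v _; rewrite wpsi_pos // exprMn.
rewrite big_split /=; congr (_ + _).
  by rewrite sumr_const card_ord -[LHS]mulr_natl mulrA.
rewrite exchange_big mulr_sumr; apply: eq_bigr => j _.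
by rewrite -mulr_suml sum_neq.
Qed.

Lemma level_negS k :
  level_neg k.+1 = n%:R * a ^+ 2 * level_neg k + (n%:R - 1) * b ^+ 2 * below_pos k.
Proof.
rewrite {1}/level_neg.
have -> : \sum_(i < n) \sum_(v <- sphere k.+1 | reduced_word ((i, false) :: v))
      f ((i, false) :: v) ^+ 2
    = \sum_(i < n) (a ^+ 2 * level_neg k + \sum_(j < n) (j != i)%:R * (b ^+ 2 *
        \sum_(v <- sphere k | reduced_word ((j, true) :: v)) f v ^+ 2)).
  apply: eq_bigr => i _.
  rewrite (sum_sphere_cons k i false (fun v => f ((i, false) :: v) ^+ 2)) addrC.
  congr (_ + _).
    rewrite mulr_sumr; apply: eq_bigr => j _; rewrite mul1r mulr_sumr.
    by apply: eq_bigr => v _; rewrite wpsi_neg // exprMn.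
  apply: eq_bigr => j _; congr (_ * _); rewrite mulr_sumr; apply: eq_bigr => v _.
  by rewrite wpsi_neg_pos // exprMn.
rewrite big_split /=; congr (_ + _).
  by rewrite sumr_const card_ord -[LHS]mulr_natl mulrA.
rewrite exchange_big -mulrA !mulr_sumr; apply: eq_bigr => j _.
by rewrite -mulr_suml sum_neq.
Qed.

Lemma level_ge0 k : 0 <= level k.
Proof. by apply: sumr_ge0 => w _; exact: sqr_ge0. Qed.

Lemma below_pos_ge0 k : 0 <= below_pos k.
Proof. by apply: sumr_ge0 => i _; apply: sumr_ge0 => w _; exact: sqr_ge0. Qed.

Lemma level_neg_ge0 k : 0 <= level_neg k.
Proof. by apply: sumr_ge0 => i _; apply: sumr_ge0 => w _; exact: sqr_ge0. Qed.

Lemma below_pos_le k : below_pos k <= n%:R * level k.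
Proof.
have -> : n%:R * level k = \sum_(i < n) level k.
  by rewrite sumr_const card_ord mulr_natl.
apply: ler_sum => i _; rewrite big_mkcond; apply: ler_sum => w _.
by case: ifP => // _; exact: sqr_ge0.
Qed.

Lemma below_pos0 : below_pos 0 = n%:R.
Proof.
rewrite /below_pos; under eq_bigr do rewrite /= big_cons big_nil /= expr1n addr0.
by rewrite sumr_const card_ord.
Qed.

Lemma level_neg0 : level_neg 0 = n%:R * a ^+ 2.
Proof.
rewrite /level_neg; under eq_bigr do rewrite /= big_cons big_nil /= addr0.
by rewrite sumr_const card_ord mulr_natl.
Qed.

(* (below_pos, level_neg) evolves by the matrix with rows (n a^2, n-1) and
   ((n-1) b^2, n a^2), with left eigenvector (b, 1). *)
Lemma growth k : b * below_pos k + level_neg k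
  = (n%:R * a ^+ 2 + (n%:R - 1) * b) ^+ k * (n%:R * (b + a ^+ 2)).
Proof.
elim: k => [|k IH]; first by rewrite below_pos0 level_neg0; ring.
by rewrite exprS -mulrA -IH below_posS level_negS; ring.
Qed.

(** For c >= |b| the vector (c, 1) is only a sub-eigenvector: its image falls short of rho (c, 1) by
    (n - 1)(c^2 - b^2) in the first entry. A positive c controls both components whatever the sign
    of b. *)
Lemma growth_le (c : R) k : (1 <= n)%N -> `|b| <= c ->
  c * below_pos k + level_neg k
  <= (n%:R * a ^+ 2 + (n%:R - 1) * c) ^+ k * (n%:R * (c + a ^+ 2)).
Proof.
move=> n1 bc; have c0 : 0 <= c := le_trans (normr_ge0 b) bc.
have n10 : 0 <= n%:R - 1 :> R by rewrite subr_ge0 ler1n.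
have b2 : b ^+ 2 <= c ^+ 2.
  by rewrite -(real_normK (num_real b)); apply: lerXn2r; rewrite ?nnegrE.
set rho := n%:R * a ^+ 2 + _.
have rho0 : 0 <= rho by apply: addr_ge0; apply: mulr_ge0; rewrite ?sqr_ge0.
elim: k => [|k IH]; first by rewrite below_pos0 level_neg0 expr0; lra.
rewrite exprS -mulrA; apply: le_trans (ler_wpM2l rho0 IH).
rewrite below_posS level_negS /rho.
have b20 : 0 <= c ^+ 2 - b ^+ 2 by rewrite subr_ge0.
by have := mulr_ge0 n10 (mulr_ge0 (below_pos_ge0 k) b20); lra.
Qed.

Lemma level_summable (c : R) : (1 <= n)%N -> `|b| <= c -> 0 < c ->
  n%:R * a ^+ 2 + (n%:R - 1) * c < 1 ->
  exists K : R, forall N, \sum_(k < N) level k <= K.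
Proof.
move=> n1 bc c0 rho1; set rho := n%:R * a ^+ 2 + _ in rho1.
have n10 : 0 <= n%:R - 1 :> R by rewrite subr_ge0 ler1n.
have rho0 : 0 <= rho by apply: addr_ge0; apply: mulr_ge0; rewrite ?sqr_ge0 ?(ltW c0).
(* The factor a^2 / c + 1 makes the weights (c, 1) dominate the weights (a^2, 1) of [levelS]. *)
pose D := (a ^+ 2 / c + 1) * (n%:R * (c + a ^+ 2)).
have D0 : 0 <= D.
  by rewrite !mulr_ge0 ?addr_ge0 ?divr_ge0 ?sqr_ge0 // ltW.
have le k : level k.+1 <= rho ^+ k * D.
  have h := growth_le k n1 bc; rewrite -/rho in h.
  rewrite levelS /D mulrCA; apply: le_trans (ler_wpM2l _ h); last first.
    by rewrite addr_ge0 ?divr_ge0 ?sqr_ge0 // ltW.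
  have -> : (a ^+ 2 / c + 1) * (c * below_pos k + level_neg k)
     = a ^+ 2 * below_pos k + level_neg k + (c * below_pos k + a ^+ 2 / c * level_neg k).
    by field; rewrite gt_eqF.
  rewrite lerDl addr_ge0 // mulr_ge0 ?below_pos_ge0 ?level_neg_ge0 ?(ltW c0) //.
  by rewrite divr_ge0 ?sqr_ge0 // ltW.
exists (level 0 + D / (1 - rho)) => N.
have rho1' : 0 < 1 - rho by lra.
have geo M : \sum_(k < M) level k.+1 <= D / (1 - rho) * (1 - rho ^+ M).
  elim: M => [|M IH]; first by rewrite big_ord0 subrr mulr0.
  rewrite big_ord_recr /=; apply: le_trans (lerD IH (le M)) _.
  rewrite le_eqVlt; apply/orP; left; apply/eqP; rewrite exprS; field.
  by rewrite gt_eqF.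
case: N => [|N]; first by rewrite big_ord0 addr_ge0 ?level_ge0 ?divr_ge0 // ltW.
rewrite big_ord_recl lerD2l; apply: le_trans (geo N) _.
rewrite ler_piMr ?divr_ge0 ?(ltW rho1') // lerBlDr lerDl exprn_ge0 //.
Qed.

Lemma psi_square_summable (c : R) : (1 <= n)%N -> `|b| <= c -> 0 < c ->
  n%:R * a ^+ 2 + (n%:R - 1) * c < 1 ->
  exists2 K : R, 0 <= K & forall A : seq (free_group n), uniq A ->
    \sum_(g <- A) sqnormc (psi a b g) <= K ^+ 2.
Proof.
move=> n1 bc c0 rho1; have [K0 K0P] := level_summable n1 bc c0 rho1.
have K00 : 0 <= K0 by have := K0P 0%N; rewrite big_ord0.
exists (Num.sqrt K0) => [|A uA]; first exact: sqrtr_ge0.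
rewrite sqr_sqrtr //; pose N := (\max_(g <- A) size (word g)).+1.
apply: le_trans (K0P N).
have -> : \sum_(g <- A) sqnormc (psi a b g)
    = \sum_(k < N) \sum_(g <- A | size (word g) == k) f (word g) ^+ 2.
  rewrite (exchange_big_dep xpredT) //= big_seq [RHS]big_seq; apply: eq_bigr => g gA.
  have gN : (size (word g) < N)%N.
    by rewrite ltnS; exact: (leq_bigmax_seq (F := fun g : free_group n => size (word g))).
  rewrite (big_pred1 (Ordinal gN)); last by move=> k; rewrite /= -val_eqE eq_sym.
  by rewrite psiE /sqnormc /= [0 ^+ 2]expr0n addr0.
apply: ler_sum => k _; rewrite /level -sum_gsphere.
rewrite -big_filter (perm_big [seq g <- gsphere k | g \in A]); last first.
  apply: uniq_perm; rewrite ?filter_uniq ?uniq_gsphere // => g.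
  by rewrite !mem_filter mem_gsphere andbC.
rewrite big_filter big_mkcond; apply: ler_sum => g _.
by case: ifP => // _; exact: sqr_ge0.
Qed.

End Spheres.

(** * Reducedness *)

Section Reducedness.
Variables (R : realType) (n : nat) (a b : R).
Local Notation C := R[i].
Local Notation G := (free_group n).

(** Inversion permutes the sphere, and f is real and invariant under it. *)
Lemma sphere_elt_adjoint k (f : G -> R) : (forall g, f (g^-1)%g = f g) ->
  is_adjoint (lam (sphere_elt (gsphere n k) f)) (lam (sphere_elt (gsphere n k) f)).
Proof.
move=> fV x y; rewrite lam_star; congr inner.
rewrite /lam /lstar /sphere_elt !big_map.
transitivity (\sum_(g <- gsphere n k) (f (g^-1)%g)%:C%C *: lreg (g^-1)%g y).
  by apply: eq_bigr => g _; rewrite fV; congr (_ *: _); exact: conjc_real.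
rewrite -(big_map (fun g : G => g^-1%g) xpredT (fun g => (f g)%:C%C *: lreg g y)).
apply: perm_big; apply: uniq_perm; rewrite ?uniq_gsphere //.
  by rewrite map_inj_uniq ?uniq_gsphere //; exact: invg_inj.
move=> g; rewrite -[g]invgK mem_map; last exact: invg_inj.
by rewrite !mem_gsphere invgK /= size_rev size_map.
Qed.

(** For s with coefficients psi on the sphere, psi(s) is the level itself, so level <= 4/3 (k + 1)
    sqrt level; squaring gives 16/9 (k + 1)^2. *)
Lemma level_le_of_reduced k : reduced_state (@psi n R a b) ->
  level n a b k <= 2 * k.+1%:R ^+ 2.
Proof.
move=> red; pose f (g : G) := wpsi a b g; pose s := sphere_elt (gsphere n k) f.
have F2E : \sum_(g <- gsphere n k) f g ^+ 2 = level n a b k.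
  exact: (sum_gsphere k (fun w => wpsi a b w ^+ 2)).
have [l0|l0] := lerP (level n a b k) 0.
  by apply: le_trans l0 _; rewrite mulr_ge0 ?sqr_ge0.
have sM : bounded_by (lam s) (k.+1%:R * Num.sqrt (level n a b k)).
  rewrite -F2E; apply: haagerup_inequality; first exact: uniq_gsphere.
  by move=> g; rewrite mem_gsphere => /eqP.
have M0 : 0 < k.+1%:R * Num.sqrt (level n a b k) by rewrite mulr_gt0 ?sqrtr_gt0 ?ltr0Sn.
have sA : is_adjoint (lam s) (lam s).
  by apply: sphere_elt_adjoint => g; rewrite /f /= wpsi_inv.
have := reduced_state_selfadjoint_le red sA M0 sM.
have -> : lext (psi a b) s = (level n a b k)%:C%C.
  rewrite /lext big_map -F2E rmorph_sum; apply: eq_bigr => g _.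
  by rewrite psiE -rmorphM expr2.
rewrite /=; have := sqr_sqrtr (ltW l0); have := sqrtr_gt0 (level n a b k); rewrite l0.
move: (Num.sqrt _) (k.+1%:R) => q K q0 <- h.
have {h} h : q <= 4 / 3 * K.
  by rewrite -(ler_pM2r q0); move: h; rewrite expr2; lra.
have := lerXn2r 2 (_ : q \in Num.nneg) (_ : _ \in Num.nneg) h.
have K0 : 0 <= K by move: q0 => /ltW; lra.
rewrite !nnegrE => /(_ (ltW q0)) /(_ (le_trans (ltW q0) h)).
by have := sqr_ge0 K; lra.
Qed.

Lemma psi_scale (r : R) (s : G) : psi (r * a) (r ^+ 2 * b) s = (r ^+ size s)%:C%C * psi a b s.
Proof.
rewrite /psi -rmorphM /=; congr (_%:C)%C.
rewrite -[in r ^+ size s](subnK (gamma_le s)) exprD exprM exprMn [(_ * b) ^+ _]exprMn.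
by ring.
Qed.

Lemma one_sub_exp_le (r : R) m : 0 <= r -> r <= 1 -> 1 - r ^+ m <= m%:R * (1 - r).
Proof.
move=> r0 r1; elim: m => [|m IH]; first by rewrite expr0; lra.
rewrite exprS -natr1; have := ler_wpM2l r0 IH.
have : 0 <= m%:R * (1 - r) * (1 - r) by rewrite !mulr_ge0 // subr_ge0.
by lra.
Qed.

(** The constant depends on s, which is enough because r -> 1 is taken with s fixed. *)
Lemma lext_psi_scale (s : seq (C * G)) : exists2 L : R, 0 <= L & forall r, 0 <= r -> r <= 1 ->
  cnorm (lext (psi a b) s - lext (psi (r * a) (r ^+ 2 * b)) s) <= L * (1 - r).
Proof.
exists (\sum_(p <- s) cnorm p.1 * cnorm (psi a b p.2) * (size p.2)%:R) => [|r r0 r1].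
  by apply: sumr_ge0 => p _; rewrite !mulr_ge0 ?cnorm_ge0.
elim: s => [|p s IH].
  by rewrite /lext !big_nil subrr mul0r (cnorm_real (0 : R)) normr0.
rewrite !lext_cons big_cons opprD addrACA mulrDl.
apply: le_trans (cnormD _ _) _; apply: lerD IH.
rewrite psi_scale -[psi a b p.2 in X in X - _]mul1r -mulrBr -mulrBl mulrA cnormM [cnorm (_ * _)]cnormM.
rewrite -(rmorph1 (real_complex R)) -rmorphB cnorm_real mulrAC -!mulrA.
rewrite ler_wpM2l ?cnorm_ge0 // ler_wpM2l ?cnorm_ge0 //.
rewrite ger0_norm; first exact: one_sub_exp_le.
by rewrite subr_ge0 exprn_ile1.
Qed.

(** Bernoulli's inequality along exponents 3 m gives rho^(3 m) >= (m d)^3, and a cube outgrows a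
    quadratic. *)
Lemma growth_unbounded (rho c K : R) : 1 < rho -> 0 < c ->
  ~ (forall k, rho ^+ k * c <= K * k.+2%:R ^+ 2).
Proof.
move=> rho1 c0 h; pose d := rho - 1; have d0 : 0 < d by rewrite subr_gt0.
have bern m : 1 + m%:R * d <= rho ^+ m.
  elim: m => [|m IH]; first by rewrite expr0 mul0r addr0.
  have rho0 : 0 <= rho by lra.
  rewrite exprS; apply: le_trans (ler_wpM2l rho0 IH); rewrite -natr1.
  have : 0 <= m%:R * d * d by rewrite !mulr_ge0 // ltW.
  by rewrite /d; lra.
(* The constant 25 comes from 3 m + 2 <= 5 m, squared; the factor m^2 is cancelled. *)
have bound (m : nat) : (0 < m)%N -> m%:R * (d ^+ 3 * c) <= 25 * K.
  move=> m0; have mp : 0 < m%:R :> R by rewrite ltr0n.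
  have := h (3 * m)%N; rewrite mulnC exprM => h1.
  have h2 : (m%:R * d) ^+ 3 <= (rho ^+ m) ^+ 3.
    apply: lerXn2r; rewrite ?nnegrE ?mulr_ge0 ?exprn_ge0 ?(ltW d0) //; first by lra.
    by have := bern m; lra.
  have h3 : (m * 3).+2%:R <= 5 * m%:R :> R by rewrite -natrM ler_nat; lia.
  have h4 : (m * 3).+2%:R ^+ 2 <= (5 * m%:R) ^+ 2 :> R.
    by apply: lerXn2r; rewrite ?nnegrE // mulr_ge0.
  have K0 : 0 <= K.
    have := h 0%N; rewrite expr0 mul1r => hK.
    have : 0 < K * 2%:R ^+ 2 by apply: lt_le_trans hK.
    by rewrite pmulr_lgt0 ?exprn_gt0 // => /ltW.
  have := ler_wpM2r (ltW c0) h2; have := ler_wpM2l K0 h4 => h5 h6.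
  rewrite -(ler_pM2l (exprn_gt0 2 mp)).
  by move: h1 h5 h6; lra.
have q0 : 0 < d ^+ 3 * c by rewrite mulr_gt0 ?exprn_gt0.
have [m hm] : exists m : nat, 25 * K / (d ^+ 3 * c) < m.+1%:R.
  by exists (Num.truncn (25 * K / (d ^+ 3 * c))); exact: truncnS_gt.
have := bound m.+1 isT; rewrite leNgt => /negP; apply.
by move: hm; rewrite ltr_pdivrMr.
Qed.

End Reducedness.

Theorem proposition3p3 (R : realType) (n : nat) (a b : R) :
  (2 <= n)%N ->
  -1 <= a -> a <= 1 ->
  (n%:R * a ^+ 2 - 1) / (n%:R - 1) <= b -> b <= 1 ->
  reduced_state (@psi n R a b) <->
  b <= (1 - n%:R * a ^+ 2) / (n%:R - 1).
Proof.
move=> n2 aN1 a1 ab b1; have n1 : (1 <= n)%N by exact: ltnW.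
have d0 : 0 < n%:R - 1 :> R by rewrite subr_gt0 ltr1n.
have asq : a ^+ 2 <= 1 by nra.
rewrite ler_pdivrMr // in ab; rewrite ler_pdivlMr //.
(* The admissible region is stable: as r^2 <= 1, n r^2 a^2 - 1 <= r^2 (n a^2 - 1) <= (n - 1) r^2
   b. *)
have psi_ok (r : R) : 0 < r -> r <= 1 -> is_state (@psi n R (r * a) (r ^+ 2 * b)).
  move=> r0 r1; have r2 : r ^+ 2 <= 1 by rewrite expr_le1 // ltW.
  have r20 := sqr_ge0 r.
  apply: psi_state.
  - by rewrite exprMn; have := ler_wpM2l r20 asq; lra.
  - by have := ler_wpM2l r20 b1; lra.
  - by rewrite exprMn; have := ler_wpM2l r20 ab; lra.
split=> [red|bu].
  rewrite leNgt; apply/negP => hb.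
  (* Adding the negated conclusion to the lower bound on b gives 2 (n - 1) b > 0, so the eigenvector
     (b, 1) is positive. *)
  have b0 : 0 < b by nra.
  have rho1 : 1 < n%:R * a ^+ 2 + (n%:R - 1) * b by lra.
  have np : 0 < n%:R :> R by rewrite ltr0n.
  have c0 : 0 < n%:R * (b + a ^+ 2) by rewrite mulr_gt0 // ltr_pwDl ?sqr_ge0.
  (* The term b * below_pos contributes 2 n (k + 2)^2, the term level_neg contributes 2 (k +
     2)^2. *)
  apply: (@growth_unbounded R _ _ (2 * n%:R + 2) rho1 c0) => k.
  rewrite -growth.
  have L1 := level_le_of_reduced k red; have L2 := level_le_of_reduced k.+1 red.
  have L3 : level_neg n a b k <= level n a b k.+1.
    by rewrite levelS lerDr mulr_ge0 ?sqr_ge0 ?below_pos_ge0.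
  have L4 : b * below_pos n a b k <= n%:R * level n a b k.
    apply: le_trans (below_pos_le n a b k).
    by rewrite ler_piMl ?below_pos_ge0.
  have L5 : k.+1%:R ^+ 2 <= k.+2%:R ^+ 2 :> R.
    by apply: lerXn2r; rewrite ?nnegrE // ler_nat.
  have L6 := ler_wpM2l (ltW np) (le_trans L1 (ler_wpM2l (ler0n R 2) L5)).
  by lra.
have red_r (r : R) : 0 < r -> r < 1 -> reduced_state (@psi n R (r * a) (r ^+ 2 * b)).
  move=> r0 r1; have r2 : r ^+ 2 < 1 by rewrite expr_lt1 // ltW.
  have r20 : 0 < r ^+ 2 by rewrite exprn_gt0.
  (* With c = r^2 |b| + delta, half of the room below 1 is spent: the rate is at most (1 + r^2) / 2.
     The addition keeps c positive when b = 0. *)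
  pose delta := (1 - r ^+ 2) / 2 / (n%:R - 1).
  have delta0 : 0 < delta by rewrite !divr_gt0 // subr_gt0.
  have babs : (n%:R - 1) * `|b| <= 1 - n%:R * a ^+ 2.
    have [b0|b0] := lerP 0 b; first by rewrite ger0_norm //; lra.
    by rewrite ltr0_norm //; lra.
  have [||||K K0 KP] := @psi_square_summable R n (r * a) (r ^+ 2 * b) (r ^+ 2 * `|b| + delta).
  - exact: n1.
  - by rewrite normrM (ger0_norm (ltW r20)); lra.
  - by rewrite ltr_wpDl // mulr_ge0 ?(ltW r20).
  - rewrite exprMn mulrDr (_ : (n%:R - 1) * delta = (1 - r ^+ 2) / 2); last first.
      by rewrite /delta mulrC divfK // gt_eqF.
    by have := ler_wpM2l (ltW r20) babs; lra.
  apply: (reduced_state_of_bounded (psi_ok r r0 (ltW r1)) K0).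
  exact: lext_le_of_square_summable.
have st : is_state (@psi n R a b) by have := psi_ok 1 ltr01 (lexx 1); rewrite expr1n !mul1r.
apply: (reduced_state_of_bounded st (ler0n R 3)) => s M sM.
have M0 := bounded_by_ge0 sM; have [L L0 LP] := lext_psi_scale a b s.
apply: (@le_of_le_eps _ _ _ (3 + L)); first by rewrite addr_ge0.
move=> e e0 e1.
(* Here [e <= 1] makes r positive. M is enlarged to M + e because [reduced_state_le] asks for a
   strictly positive bound, and M may be 0. *)
pose e' := e / 2; pose r := 1 - e'; have r0 : 0 < r by rewrite /r /e'; lra.
have r1 : r < 1 by rewrite /r /e'; lra.
have Me : bounded_by (lam s) (M + e) by apply: bounded_by_le sM; lra.
have Me0 : 0 < M + e by lra.
have h1 := reduced_state_le (psi_herm _ _) (red_r r r0 r1) Me0 Me.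
have h2 := LP r (ltW r0) (ltW r1).
rewrite -(subrK (lext (psi (r * a) (r ^+ 2 * b)) s) (lext _ s)).
apply: le_trans (cnormD _ _) _.
have h3 : L * (1 - r) <= L * e by rewrite ler_wpM2l // /r /e'; lra.
by lra.
Qed.
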